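(* Let $(X,m)$ be a compact metric measure space, where $X$ is geodesic and $m$ is a Borel probability measure on $X$ with full support. Assume that $(X,m)$ is doubling, supports the Poincaré inequality, and has the Sobolev-to-Lipschitz property. Then for every integer $k\ge1$, $$\lim_{p\to\infty}\overline{\lambda}_{k,p}(X,m)^{1/p}=\lim_{p\to\infty}\underline{\lambda}_{k,p}(X,m)^{1/p}=\mathrm{pack}_{k+1}(X)^{-1}.$$
   Context: $|x,y|$ denotes the distance in $X$, and $U_r(x)$ the open $r$-ball around $x$. $X$ is geodesic if for any $x,y\in X$ there is a continuous curve $\sigma:[0,1]\to X$ with $\sigma(0)=x$, $\sigma(1)=y$ and $|\sigma(s),\sigma(t)|=|x,y||s-t|$ for all $s,t\in[0,1]$. $\mathrm{Lip}(X)$ is the set of Lipschitz functions $X\to\mathbb R$, and $\mathrm{Lip}(f)$ is the (global) Lipschitz constant of $f$. For $f\in \mathrm{Lip}(X)$ the local Lipschitz constant is $\mathrm{lip}(f)(x)=\lim_{r\to0+}\sup_{y\in U_r(x)\setminus\{x\}}\frac{|f(x)-f(y)|}{|x,y|}$. Norms $\|\cdot\|_p$ are those of $L^p(X,m)$. Write $\frac{1}{m(B)}\int_B f\,dm=f_B$. Doubling: there is $C_D>0$ such that $m(U_{2r}(x))\le C_D\,m(U_r(x))$ for all $x\in X$, $r>0$. Supports the Poincaré inequality: there are $p_0\ge1$, $C_P>0$, $\sigma\ge1$ such that for all $x\in X$, $r>0$ and $f\in \mathrm{Lip}(X)$, $$\frac{1}{m(U_r(x))}\int_{U_r(x)}|f-f_{U_r(x)}|\,dm\le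 C_P\,r\left(\frac{1}{m(U_{\sigma r}(x))}\int_{U_{\sigma r}(x)}\mathrm{lip}(f)^{p_0}\,dm\right)^{1/p_0}.$$ Minimal relaxed gradient: for $f\in L^2(X,m)$, a function $h\in L^2(X,m)$ is a relaxed gradient of $f$ if there are Lipschitz functions $f_n\to f$ in $L^2$ such that $\mathrm{lip}(f_n)$ converges weakly in $L^2$ to some $\tilde h$ with $\tilde h\le h$ $m$-a.e.; if $f$ has a relaxed gradient, $|Df|_\ast$ denotes the (unique) relaxed gradient of minimal $L^2$-norm. For $1<p\le\infty$, $W^{1,p}(X,m)$ is the space of $f\in L^p(X,m)$ for which the $(1,p)$-norm is finite, where $\|f\|_{1,p}=(\|f\|_p^p+\||Df|_\ast\|_p^p)^{1/p}$ (for $p=\infty$: both $f$ and $|Df|_\ast$ are in $L^\infty$). Sobolev-to-Lipschitz property: every $f\in W^{1,2}(X,m)\cap W^{1,\infty}(X,m)$ has a Lipschitz representative $\tilde f$ with $\mathrm{Lip}(\tilde f)=\||Df|_\ast\|_\infty$. For a non-empty open set $\Omega\subset X$ and $p>1$, $$\lambda_{1,p}^D(\Omega)=\inf\left\{\frac{\|\mathrm{lip}(f)\|_p^p}{\|f\|_p^p}\ :\ f\in \mathrm{Lip}_0(\Omega)\setminus\{0\}\right\},$$ where $\mathrm{Lip}_0(\Omega)$ is the set of Lipschitz functions with compact support in $\Omega$. For $k\ge1$, $$\overline{\lambda}_{k,p}(X,m):=\inf_{A_0,\dots,A_k}\max_{0\le i\le k}\lambda_{1,p}^D(A_i),\qquad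 \underline{\lambda}_{k,p}(X,m):=\frac1{k+1}\inf_{A_0,\dots,A_k}\sum_{i=0}^k\lambda_{1,p}^D(A_i),$$ the infima being over families of mutually disjoint non-empty open subsets of $X$. Finally $$\mathrm{pack}_{k+1}(X):=\frac12\max_{x_0,\dots,x_k\in X}\min_{i\ne j}|x_i,x_j|.$$ *)

(* Defs.v *)
From HB Require Import structures.
From mathcomp Require Import all_boot all_order all_algebra.
From mathcomp Require Import all_classical all_reals all_analysis.

Set Implicit Arguments.
Unset Strict Implicit.
Unset Printing Implicit Defensive.

Import Order.TTheory GRing.Theory Num.Theory.
Import numFieldNormedType.Exports.

Local Open Scope classical_set_scope.
Local Open Scope ring_scope.

HB.mixin Record Metric_isBorel (K : numDomainType) (d : measure_display) M
    & Metric K M & Measurable d M := {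
  measurable_borel : @measurable d M = <<s @open M >>
}.

#[short(type="borelMetricType")]
HB.structure Definition BorelMetric (K : numDomainType) (d : measure_display) :=
  { M of Metric K M & Measurable d M & Metric_isBorel K d M }.

Section metric.
Context {R : realType} {d : measure_display} (X : borelMetricType R d).

Definition geodesic :=
  forall x y : X, exists s : R -> X,
    [/\ {within `[0, 1], continuous s}, s 0 = x, s 1 = y &
        forall t u : R, t \in `[0, 1] -> u \in `[0, 1] ->
          mdist (s t) (s u) = mdist x y * `|t - u|].

(* The pairs [ij] range over the pairs of distinct indices. On a compact space
   the supremum over the [n]-point configurations is attained. *)
Definition pack (n : nat) : \bar R :=
  ((2^-1)%:E * ereal_sup [set
     \big[mine/+oo]_(ij : 'I_n * 'I_n | ij.1 != ij.2)
       (mdist (x ij.1) (x ij.2))%:E | x in [set: 'I_n -> X]])%E.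

Definition disjoint_open_families (k : nat) : set ('I_k.+1 -> set X) :=
  [set A | [/\ forall i, open (A i), forall i, A i !=set0 & trivIset setT A]].

End metric.
Arguments disjoint_open_families {R d} X k.

Section lipschitz.
Context {R : realType} {d : measure_display} {X : borelMetricType R d}.
Implicit Types (f : X -> R) (C : R) (x : X).

Definition lipschitz_with C f :=
  forall x y, `|f x - f y| <= C * mdist x y.

Definition is_lipschitz f := exists C, lipschitz_with C f.

Definition lip_const f : \bar R :=
  ereal_inf [set C%:E | C in [set C | 0 <= C /\ lipschitz_with C f]].

(* [sup set0 = 0], so that [lip f x = 0] at an isolated point [x]. For a
   Lipschitz function the suprema are finite and nondecreasing in [r]. *)
Definition lip f x : R :=
  lim (sup [set `|f x - f y| / mdist x y | y in ball x r `\ x] @[r --> 0^'+]).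

Definition lip0 (A : set X) : set (X -> R) :=
  [set f | [/\ is_lipschitz f, compact (closure [set x | f x != 0]) &
               closure [set x | f x != 0] `<=` A]].

End lipschitz.

Section metric_measure.
Context {R : realType} {d : measure_display} {X : borelMetricType R d}.
Variable m : {measure set X -> \bar R}.
Implicit Types (f g h : X -> R) (p : \bar R).

Definition full_support :=
  forall U : set X, open U -> U !=set0 -> (0 < m U)%E.

Definition doubling :=
  exists2 C : R, 0 < C &
    forall (x : X) (r : R), 0 < r -> (m (ball x (2 * r)) <= C%:E * m (ball x r))%E.

Definition mean (B : set X) f : R :=
  (fine (m B))^-1 * \int[m]_(x in B) f x.

Definition poincare :=
  exists p0 C s : R, [/\ 1 <= p0, 0 < C, 1 <= s &
    forall (x : X) (r : R) f, 0 < r -> is_lipschitz f ->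
      mean (ball x r) (fun y => `|f y - mean (ball x r) f|) <=
      C * r * mean (ball x (s * r)) (fun y => lip f y `^ p0) `^ p0^-1].

Definition weak_cvgL2 (u : nat -> X -> R) h :=
  [/\ forall n, u n \in Lfun m 2%:E, h \in Lfun m 2%:E &
      forall g, g \in Lfun m 2%:E ->
        \int[m]_x (u n x * g x) @[n --> \oo] --> \int[m]_x (h x * g x)].

Definition relaxed_gradient f h :=
  [/\ f \in Lfun m 2%:E, h \in Lfun m 2%:E &
      exists (u : nat -> X -> R) (h' : X -> R),
        [/\ forall n, is_lipschitz (u n),
            ('N[m]_2%:E[EFin \o (u n \- f)%R])%E @[n --> \oo] --> 0%E,
            weak_cvgL2 (fun n => lip (u n)) h' &
            {ae m, forall x, h' x <= h x}]].

(* The relaxed gradient of least L2-norm, determined up to a null set. The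
   default value is used only when [f] has no such gradient. *)
Definition min_relaxed_gradient f : X -> R :=
  xget (cst 0) [set h | relaxed_gradient f h /\
    forall h', relaxed_gradient f h' ->
      ('N[m]_2%:E[EFin \o h] <= 'N[m]_2%:E[EFin \o h'])%E].

Definition finite_sobolev_norm p f : Prop :=
  let Df := min_relaxed_gradient f in
  match p return Prop with
  | r%:E%E =>
    ((('N[m]_p[EFin \o f] `^ r + 'N[m]_p[EFin \o Df] `^ r) `^ r^-1) < +oo)%E
  | _ => f \in Lfun m p /\ Df \in Lfun m p
  end.

(* Membership in W^(1,p), for 1 < p <= +oo. *)
Definition sobolev p : set (X -> R) :=
  [set f | [/\ f \in Lfun m p, exists h, relaxed_gradient f h &
               finite_sobolev_norm p f]].

Definition sobolev_to_lipschitz :=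
  forall f, sobolev 2%:E f -> sobolev +oo%E f ->
    exists g, [/\ is_lipschitz g, {ae m, forall x, g x = f x} &
      lip_const g = 'N[m]_+oo[EFin \o min_relaxed_gradient f]%E].

Definition dirichlet_lambda (p : R) (A : set X) : \bar R :=
  ereal_inf [set ('N[m]_p%:E[EFin \o lip f] `^ p / 'N[m]_p%:E[EFin \o f] `^ p)%E
            | f in lip0 A `\ cst 0].

Definition lambda_max (k : nat) (p : R) : \bar R :=
  ereal_inf [set \big[maxe/-oo%E]_(i < k.+1) dirichlet_lambda p (A i)
            | A in disjoint_open_families X k].

Definition lambda_mean (k : nat) (p : R) : \bar R :=
  ((k.+1%:R^-1)%:E *
   ereal_inf [set (\sum_(i < k.+1) dirichlet_lambda p (A i))%E
             | A in disjoint_open_families X k])%E.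

End metric_measure.

(* Main.v *)
Require Import Defs.
From HB Require Import structures.
From mathcomp Require Import all_boot all_order all_algebra.
From mathcomp Require Import all_classical all_reals all_analysis.
From mathcomp Require Import measurable_realfun ess_sup_inf.
From mathcomp Require Import ring lra.

Set Implicit Arguments.
Unset Strict Implicit.
Unset Printing Implicit Defensive.

Import Order.TTheory GRing.Theory Num.Theory.
Import numFieldNormedType.Exports.

Local Open Scope classical_set_scope.
Local Open Scope ring_scope.

(** The upper bound is elementary. If the balls of radius [r] around [x_0, ..., x_k]
    are disjoint, the cones over them have slope at most [1], and their [p]-norms tend
    to their maximum [r]; so both quantities are eventually at most [(1 / r + e) ^ p]
    ([lambda_max_le_near]). Moreover [lambda_max / (k + 1) <= lambda_mean <=
    lambda_max], and the factor [k + 1] disappears in the [p]-th root.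

    For the lower bound, suppose that [lambda_max < c ^ p] for arbitrarily large [p],
    and choose disjointly supported test functions with Rayleigh quotients below
    [c ^ p] and maximum [1]. Doubling and the Poincare inequality bound their moduli
    of continuity uniformly in [p] ([morrey_modulus]), so they converge uniformly
    along an ultrafilter ([equicontinuous_ultralimit]) to functions [f_i] with
    disjoint supports and maximum [1]. If each [f_i] is [c']-Lipschitz for every
    [c' > c], then on a geodesic between points where [f_i] and [f_j] are maximal both
    functions vanish somewhere, so these points have distance at least [2 / c']
    ([disjoint_lipschitz_dist]); hence [1 / c] is at most the packing radius.

    The sharp Lipschitz constant comes from the Sobolev-to-Lipschitz property, which
    requires the minimal relaxed gradient of [f_i] to be at most [c']. Weak limits are
    avoided by means of strong gradients: [h] is a strong gradient of [f] if Lipschitz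
    functions [w] near [f] have slopes below functions near [h], all in [L2]. The part
    of the slopes above [c'] tends to [0] in [L2] as [p] grows, so the constant [c'] is
    a strong gradient of [f_i] ([strong_gradient_energy_limit]). Strong and relaxed
    gradients coincide: in one direction by minimizing the norm of the slopes over
    decreasing convex families, in the other by Mazur's argument in the form of the
    projection onto a convex set; both rest on the parallelogram identity
    ([min_norm_cvg]). Finally, strong gradients can be glued along Lipschitz cutoffs,
    hence, cutoffs being dense, along Borel sets: if [h] and [c'] are strong gradients
    of [f], so is [min h c'] ([strong_gradient_min]). Therefore the minimal gradient
    does not exceed [c'] ([minimal_gradient_le]). *)

(** * Local Lipschitz constants *)

Section local_lipschitz.
Context {R : realType} {d : measure_display} {X : borelMetricType R d}.
Implicit Types (f g u v : X -> R) (x y : X).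

Lemma open_measurable_borel (A : set X) : open A -> measurable A.
Proof. by move=> oA; rewrite measurable_borel; exact: sub_sigma_algebra. Qed.

Lemma open_ballX x r : open (ball x r).
Proof.
rewrite ballEmdist openE => y /= xy.
rewrite /interior; apply/nbhs_ballP; exists (r - mdist x y) => /=.
  by rewrite subr_gt0.
move=> z; rewrite ballEmdist /= => yz.
by have := metric_triangle x y z; lra.
Qed.

Lemma measurable_ballX x r : measurable (ball x r).
Proof. exact/open_measurable_borel/open_ballX. Qed.

Lemma lower_open_measurable f :
  (forall a, open [set x | a < f x]) -> measurable_fun setT f.
Proof.
move=> fo; apply: (measurability _ (RGenOInfty.measurableE R)).
move=> _ [_ [a ->] <-]; rewrite setTI.
have -> : f @^-1` `]a, +oo[%classic = [set x | a < f x].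
  by apply/seteqP; split => x /=; rewrite in_itv/= andbT.
exact/open_measurable_borel.
Qed.

Lemma is_lipschitzW f : is_lipschitz f -> exists2 C, 0 <= C & lipschitz_with C f.
Proof.
move=> [C fC]; exists `|C| => // x y; apply: le_trans (fC x y) _.
by rewrite ler_wpM2r ?mdist_ge0// ler_norm.
Qed.

Lemma lipschitz_with_gt0 f : is_lipschitz f -> exists2 C, 0 < C & lipschitz_with C f.
Proof.
move=> /is_lipschitzW[C C0 fC]; exists (C + 1); first lra.
move=> x y; apply: le_trans (fC x y) _.
by rewrite ler_wpM2r ?mdist_ge0//; lra.
Qed.

Lemma lipschitz_continuous f : is_lipschitz f -> continuous f.
Proof.
move=> /lipschitz_with_gt0[C C0 fC] x; apply/cvgrPdist_lt => e e0.
apply/nbhs_ballP; exists (e / C) => /=; first exact: divr_gt0.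
move=> y; rewrite ballEmdist /= => xy; apply: le_lt_trans (fC x y) _.
by rewrite mulrC -ltr_pdivlMr.
Qed.

Lemma continuous_measurable_borel f : continuous f -> measurable_fun setT f.
Proof.
move=> cf; apply: lower_open_measurable => a.
have -> : [set x | a < f x] = f @^-1` [set z | a < z] by [].
by apply: open_comp => //; exact: open_gt.
Qed.

Lemma measurable_lipschitz f : is_lipschitz f -> measurable_fun setT f.
Proof. by move=> /lipschitz_continuous; exact: continuous_measurable_borel. Qed.

(** The supremum whose limit as [r] decreases to [0] is [lip f x]. *)
Definition slope_sup f x (r : R) : R :=
  sup [set `|f x - f y| / mdist x y | y in ball x r `\ x].

Lemma slope_sup_ge0 f x r : 0 <= slope_sup f x r.
Proof.
rewrite /slope_sup; set A := (X in sup X).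
have [hA|nA] := pselect (has_sup A); last by rewrite sup_out.
have [[t At] ubA] := hA; apply: le_trans (ub_le_sup ubA At).
by have [y _ <-] := At; rewrite divr_ge0 ?mdist_ge0.
Qed.

Lemma slope_sup_le f x r a : 0 <= a ->
  (forall y, mdist x y < r -> `|f x - f y| <= a * mdist x y) ->
  slope_sup f x r <= a.
Proof.
move=> a0 H; rewrite /slope_sup; set A := (X in sup X).
have [->|/set0P A0] := eqVneq A set0; first by rewrite sup0.
apply: ge_sup => // _ [y [xy yx] <-]; rewrite ballEmdist /= in xy.
rewrite ler_pdivrMr ?H// mdist_gt0; apply/eqP => E; exact: yx.
Qed.

Lemma has_ubound_slopes f x r : is_lipschitz f ->
  has_ubound [set `|f x - f y| / mdist x y | y in ball x r `\ x].
Proof.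
move=> [C fC]; exists C => _ [y [_ yx] <-].
by rewrite ler_pdivrMr// mdist_gt0; apply/eqP => E; exact: yx.
Qed.

Lemma le_slope_sup f x r y : is_lipschitz f -> mdist x y < r ->
  `|f x - f y| <= slope_sup f x r * mdist x y.
Proof.
move=> Lf xy; have [->|xNy] := eqVneq x y.
  by rewrite subrr normr0 mdistxx mulr0.
rewrite -ler_pdivrMr ?mdist_gt0//; apply: ub_le_sup.
  exact: has_ubound_slopes.
exists y => //; split; first by rewrite ballEmdist.
by move=> E; rewrite E eqxx in xNy.
Qed.

Lemma slope_sup_nd f x : is_lipschitz f ->
  {homo slope_sup f x : r s / r <= s}.
Proof.
move=> Lf r s rs; apply: slope_sup_le; first exact: slope_sup_ge0.
by move=> y xy; apply: le_slope_sup => //; exact: lt_le_trans rs.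
Qed.

(** The suprema decrease with [r] and are bounded below, so the limit that defines
    [lip] exists. *)
Lemma cvg_slope_sup f x : is_lipschitz f ->
  slope_sup f x r @[r --> 0^'+] --> lip f x.
Proof.
move=> Lf; have /cvg_ex[l fl] : cvg (slope_sup f x r @[r --> 0^'+]).
  apply/cvg_ex; eexists.
  apply: (@nondecreasing_at_right_cvgr _ _ 0 (BInfty _ false)) => //.
    by move=> r s _ _; exact: slope_sup_nd.
  by exists 0 => _ [r _ <-]; exact: slope_sup_ge0.
by have -> : lip f x = l by apply: cvg_lim.
Qed.

Lemma lip_ge0 f x : is_lipschitz f -> 0 <= lip f x.
Proof.
move=> Lf; have clf := @cvg_slope_sup _ x Lf.
apply: (cvgr_to_ge clf).
by apply: nearW => r; exact: slope_sup_ge0.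
Qed.

(** Together with [lip_lub], the form in which [lip] is used: [lip f x] is the
    least [a] such that [f] is [(a + e)]-Lipschitz at [x] at small scales. *)
Lemma lip_ub f x e : is_lipschitz f -> 0 < e ->
  exists2 r, 0 < r & forall y, mdist x y < r ->
    `|f x - f y| <= (lip f x + e) * mdist x y.
Proof.
move=> Lf e0; have := @cvg_slope_sup _ x Lf.
move=> /cvgrPdist_lt/(_ _ e0) H.
have [r [r0 Hr]] : exists r : R, 0 < r /\ `|lip f x - slope_sup f x r| < e.
  near (0 : R)^'+ => r; exists r; split => //; near: r => //.
exists r => // y xy; apply: le_trans (le_slope_sup Lf xy) _.
rewrite ler_wpM2r ?mdist_ge0//.
by move: Hr; rewrite ltr_norml => /andP[]; lra.
Unshelve. all: by end_near. Qed.

Lemma lip_lub f x a : is_lipschitz f -> 0 <= a ->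
  (forall e, 0 < e -> exists2 r, 0 < r & forall y, mdist x y < r ->
    `|f x - f y| <= (a + e) * mdist x y) -> lip f x <= a.
Proof.
move=> Lf a0 H; apply/ler_addgt0Pr => e e0.
have [r r0 Hr] := H _ e0; have clf := @cvg_slope_sup _ x Lf.
apply: (cvgr_to_le clf).
near=> s; apply: slope_sup_le; first lra.
move=> y xy; apply: Hr; apply: lt_trans xy _.
by near: s; exact: nbhs_right_lt.
Unshelve. all: by end_near. Qed.

Lemma lip_le f x C : 0 <= C -> lipschitz_with C f -> lip f x <= C.
Proof.
move=> C0 fC; apply: lip_lub => //; first by exists C.
move=> e e0; exists 1 => // y _; apply: le_trans (fC x y) _.
by rewrite ler_wpM2r ?mdist_ge0//; lra.
Qed.

(** A point [y] witnessing a slope larger than [a] at [x] also witnesses it at the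
    points near [x]: the suprema are lower semicontinuous. *)
Lemma open_slope_sup f r : is_lipschitz f -> forall a, open [set x | a < slope_sup f x r].
Proof.
move=> Lf a; have [a0|a0] := ltP a 0.
  have -> : [set x | a < slope_sup f x r] = setT.
    by apply/seteqP; split => x //= _; apply: lt_le_trans a0 (slope_sup_ge0 _ _ _).
  exact: openT.
rewrite openE => x /= ax; rewrite /interior.
have [y [xy yx ay]] : exists y, [/\ mdist x y < r, x != y & a < `|f x - f y| / mdist x y].
  apply: contrapT => H; move: ax; apply/negP; rewrite -leNgt.
  apply: slope_sup_le => // y xy; have [->|xNy] := eqVneq x y.
    by rewrite subrr normr0 mdistxx mulr0.
  rewrite -ler_pdivrMr ?mdist_gt0// leNgt; apply/negP => ay.
  by apply: H; exists y.
have cd : (fun z => mdist z y) @ x --> mdist x y.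
  apply: (@lipschitz_continuous (fun z => mdist z y)); exists 1 => z w.
  rewrite mul1r ler_norml; have := metric_triangle z w y.
  by have := metric_triangle w z y; rewrite (metric_sym w z); lra.
have cf : (fun z => `|f z - f y|) @ x --> `|f x - f y|.
  apply: cvg_norm; apply: cvgB; last exact: cvg_cst.
  exact: lipschitz_continuous.
have cq : (fun z => `|f z - f y| / mdist z y) @ x --> `|f x - f y| / mdist x y.
  by apply: cvgM => //; apply: cvgV => //; rewrite gt_eqF// mdist_gt0.
have xy0 : 0 < mdist x y by rewrite mdist_gt0.
near=> z.
have zy0 : 0 < mdist z y by near: z; apply: (cvgr_gt _ cd).
have zyr : mdist z y < r by near: z; apply: (cvgr_lt _ cd).
have : a < `|f z - f y| / mdist z y by near: z; apply: (cvgr_gt _ cq).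
rewrite ltr_pdivlMr// => H; have := le_slope_sup Lf zyr.
by move/(lt_le_trans H); rewrite ltr_pM2r.
Unshelve. all: by end_near. Qed.

Lemma measurable_lip f : is_lipschitz f -> measurable_fun setT (lip f).
Proof.
move=> Lf; apply: (@measurable_fun_cvg _ _ _ _ (fun n x => slope_sup f x n.+1%:R^-1)).
  by move=> n; apply: lower_open_measurable; exact: open_slope_sup.
move=> x _; have /cvg_at_rightP := @cvg_slope_sup _ x Lf.
apply; split => //.
  exact: cvg_harmonic.
Qed.

End local_lipschitz.

(** * Leibniz inequality for the local Lipschitz constant *)

Section lipschitz_operations.
Context {R : realType} {d : measure_display} {X : borelMetricType R d}.
Implicit Types (f g u v : X -> R) (x y : X).

Lemma lip_scale f a x : is_lipschitz f ->
  is_lipschitz (fun x => a * f x) /\ lip (fun x => a * f x) x <= `|a| * lip f x.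
Proof.
move=> Lf; have Laf : is_lipschitz (fun x => a * f x).
  have [C C0 fC] := is_lipschitzW Lf; exists (`|a| * C) => y z.
  by rewrite -mulrBr normrM -mulrA ler_wpM2l.
split => //; apply: lip_lub => //; first by rewrite mulr_ge0// lip_ge0.
move=> e e0; have e'0 : 0 < e / (`|a| + 1).
  by rewrite divr_gt0// ltr_wpDl.
have [r r0 Hr] := @lip_ub _ _ _ _ x _ Lf e'0; exists r => // y xy.
rewrite -mulrBr normrM; apply: le_trans (ler_wpM2l _ (Hr _ xy)) _ => //.
rewrite mulrA ler_wpM2r ?mdist_ge0// mulrDr lerD2l mulrCA.
rewrite ger_pMr// ler_pdivrMr ?mul1r; last by rewrite ltr_wpDl.
lra.
Qed.

Lemma compact_continuous_bounded f : compact [set: X] -> continuous f ->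
  exists2 M, 0 <= M & forall x, `|f x| <= M.
Proof.
move=> cX cf; have /compact_bounded[M [_ HM]] : compact (f @` setT).
  by apply: continuous_compact => //; exact: continuous_subspaceT.
exists (`|M| + 1); first by rewrite addr_ge0.
move=> x; apply: HM; last by exists x.
by rewrite (le_lt_trans (ler_norm M))// ltrDl.
Qed.

Lemma compact_lipschitz_bounded f : compact [set: X] -> is_lipschitz f ->
  exists2 M, 0 <= M & forall x, `|f x| <= M.
Proof.
by move=> cX Lf; apply: compact_continuous_bounded => //; exact: lipschitz_continuous.
Qed.

(** Arranged so that the increments of [u] and [v] carry the weights at [x] only,
    and the increment of the weight multiplies the gap between [u] and [v]. *)
Lemma increment_interpolation f u v x y :
  ((1 - f x) * u x + f x * v x) - ((1 - f y) * u y + f y * v y) =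
  (1 - f x) * (u x - u y) + f x * (v x - v y) + (f x - f y) * (v y - u y).
Proof. by ring. Qed.

(** The Leibniz inequality behind the gluing of gradients: the extra term is small
    when [u] and [v] approximate the same function. *)
Lemma lip_interpolation f u v L : compact [set: X] ->
  0 <= L -> lipschitz_with L f -> (forall x, 0 <= f x <= 1) ->
  is_lipschitz u -> is_lipschitz v ->
  is_lipschitz (fun x => (1 - f x) * u x + f x * v x) /\
  forall x, lip (fun x => (1 - f x) * u x + f x * v x) x <=
    (1 - f x) * lip u x + f x * lip v x + L * `|u x - v x|.
Proof.
move=> cX L0 fL f01 Lu Lv.
have [Cu Cu0 uC] := is_lipschitzW Lu; have [Cv Cv0 vC] := is_lipschitzW Lv.
have [Mu Mu0 uM] := compact_lipschitz_bounded cX Lu.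
have [Mv Mv0 vM] := compact_lipschitz_bounded cX Lv.
have tri y z A B C : 0 <= A -> 0 <= B -> 
    `|u y - u z| <= A -> `|v y - v z| <= B -> `|v z - u z| <= C ->
   `|((1 - f y) * u y + f y * v y) - ((1 - f z) * u z + f z * v z)| <=
   (1 - f y) * A + f y * B + L * mdist y z * C.
  move=> A0 B0 uA vB uvC; rewrite increment_interpolation.
  have /andP[fy0 fy1] := f01 y.
  apply: le_trans (ler_normD _ _) _; apply: lerD.
    apply: le_trans (ler_normD _ _) _; rewrite !normrM.
    rewrite (ger0_norm fy0) ger0_norm ?subr_ge0//.
    by apply: lerD; apply: ler_wpM2l => //; rewrite subr_ge0.
  by rewrite normrM; apply: ler_pM.
have Lw : is_lipschitz (fun x => (1 - f x) * u x + f x * v x).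
  exists (Cu + Cv + L * (Mu + Mv)) => y z.
  have uvM : `|v z - u z| <= Mu + Mv.
    by apply: le_trans (ler_normB _ _) _; rewrite addrC lerD.
  apply: le_trans (tri y z _ _ _ _ _ (uC y z) (vC y z) uvM) _.
  - by rewrite mulr_ge0 ?mdist_ge0.
  - by rewrite mulr_ge0 ?mdist_ge0.
  have /andP[fy0 fy1] := f01 y.
  rewrite [leRHS]mulrDl; apply: lerD; last by rewrite mulrAC.
  rewrite [leRHS]mulrDl.
  by apply: lerD; apply: ler_piMl; rewrite ?mulr_ge0 ?mdist_ge0//; lra.
split => // x; have /andP[fx0 fx1] := f01 x.
have lu0 := lip_ge0 x Lu; have lv0 := lip_ge0 x Lv.
have uv0 : 0 <= `|u x - v x| by [].
apply: lip_lub => //.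
  by rewrite !addr_ge0// mulr_ge0// subr_ge0.
move=> e e0.
have e'0 : 0 < e / 2 by lra.
have K0 : 0 < L * (Cu + Cv) + 1 by rewrite ltr_wpDl// mulr_ge0// addr_ge0.
have [r1 r10 H1] := @lip_ub _ _ _ _ x _ Lu e'0.
have [r2 r20 H2] := @lip_ub _ _ _ _ x _ Lv e'0.
have r30 : 0 < e / 2 / (L * (Cu + Cv) + 1) by rewrite divr_gt0.
exists (Num.min r1 (Num.min r2 (e / 2 / (L * (Cu + Cv) + 1)))).
  by rewrite !lt_min r10 r20 r30.
move=> y; rewrite !lt_min => /and3P[y1 y2 y3].
have dxy : 0 <= mdist x y := mdist_ge0 _ _.
have uvC : `|v y - u y| <= `|u x - v x| + (Cu + Cv) * mdist x y.
  have -> : v y - u y = (u x - u y) - (v x - v y) - (u x - v x) by ring.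
  apply: le_trans (ler_normB _ _) _; rewrite addrC lerD2l.
  by apply: le_trans (ler_normB _ _) _; rewrite mulrDl lerD.
apply: le_trans (tri x y _ _ _ _ _ (H1 _ y1) (H2 _ y2) uvC) _.
- by rewrite mulr_ge0// addr_ge0// ltW.
- by rewrite mulr_ge0// addr_ge0// ltW.
have LC : L * ((Cu + Cv) * mdist x y) <= e / 2.
  move: y3; rewrite ltr_pdivlMr// => /ltW; apply: le_trans.
  by rewrite mulrA mulrC ler_wpM2l// lerDl.
rewrite [X in X <= _](_ : _ = ((1 - f x) * lip u x + f x * lip v x + L * `|u x - v x|
   + (e / 2 + L * ((Cu + Cv) * mdist x y))) * mdist x y); last by ring.
rewrite ler_wpM2r// lerD2l; lra.
Qed.

End lipschitz_operations.

(** * The Hilbert space of square integrable functions *)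

Section square_integrable.
Context d (T : measurableType d) (R : realType) (m : probability T R).
Implicit Types f g h : T -> R.
Local Notation L2 := (Lfun m 2%:E).

(** Meaningful for square integrable functions only: elsewhere the real-valued
    integral takes a default value. *)
Definition sqn f : R := \int[m]_x (f x ^+ 2).
Definition dotp f g : R := \int[m]_x (f x * g x).

Lemma L2_measurable f : f \in L2 -> measurable_fun setT f.
Proof. by move=> /sub_Lfun_mfun; rewrite inE. Qed.

Lemma L2P f : f \in L2 <->
  measurable_fun setT f /\ m.-integrable setT (EFin \o (fun x => f x ^+ 2)).
Proof.
split; first by move=> f2; split; [exact: L2_measurable|exact: Lfun2_integrable_sqr].
move=> [mf /integrableP[_ fi]]; rewrite inE; apply/andP; split; rewrite inE//=.
rewrite /finite_norm unlock poweR_lty//.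
apply: le_lt_trans fi; rewrite le_eqVlt; apply/orP; left; apply/eqP.
by apply: eq_integral => x _ /=; rewrite powR_mulrn// -normrX.
Qed.

Lemma L2_sqr_integrable f : f \in L2 -> m.-integrable setT (EFin \o (fun x => f x ^+ 2)).
Proof. by move=> /L2P[]. Qed.

Lemma L2_le f g : measurable_fun setT f -> (forall x, `|f x| <= `|g x|) ->
  g \in L2 -> f \in L2.
Proof.
move=> mf fg /L2P[mg ig]; apply/L2P; split => //.
apply: (le_integrable measurableT _ _ ig).
  by apply/measurable_EFinP; exact: measurable_funX.
by move=> x _ /=; rewrite lee_fin !normrX ler_pXn2r// nnegrE.
Qed.

Lemma L2D f g : f \in L2 -> g \in L2 -> (fun x => f x + g x) \in L2.
Proof. by move=> f2 g2; have [_] := @Lfun_addr_closed _ _ _ m 2%:E (lee1n 2); apply. Qed.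

Lemma L2Z f a : f \in L2 -> (fun x => a * f x) \in L2.
Proof.
move=> /(@Lfun_scale _ _ _ m f a 2) => H.
rewrite (_ : (fun x => a * f x) = a \o* f); first by apply: H; rewrite ler1n.
by apply/funext => x /=; rewrite mulrC.
Qed.

Lemma L2B f g : f \in L2 -> g \in L2 -> (fun x => f x - g x) \in L2.
Proof.
move=> f2 /(L2Z (-1)) g2; rewrite (_ : (fun x => _) = (fun x => f x + -1 * g x)).
  exact: L2D.
by apply/funext => x; rewrite mulN1r.
Qed.

Lemma L2_bounded f M : measurable_fun setT f -> (forall x, `|f x| <= M) -> f \in L2.
Proof.
move=> mf fM; apply: (@L2_le _ (cst M)) => //; last exact: Lfun_cst.
by move=> x; rewrite (le_trans (fM x))// ler_norm.
Qed.

Lemma L2_dot f g : f \in L2 -> g \in L2 ->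
  m.-integrable setT (EFin \o (fun x => f x * g x)).
Proof. by move=> f2 g2; apply/Lfun1_integrable; exact: Lfun2_mul_Lfun1. Qed.

Lemma integrable_lin a b f g : m.-integrable setT (EFin \o f) ->
  m.-integrable setT (EFin \o g) ->
  m.-integrable setT (EFin \o (fun x => a * f x + b * g x)).
Proof.
move=> fi gi; rewrite (_ : EFin \o _ = (fun x => a%:E * (EFin \o f) x)%E \+
    (fun x => b%:E * (EFin \o g) x)%E)%E; last by apply/funext.
by apply: integrableD => //; apply: integrableZl.
Qed.

Lemma Rintegral_lin a b f g : m.-integrable setT (EFin \o f) ->
  m.-integrable setT (EFin \o g) ->
  \int[m]_x (a * f x + b * g x) = a * \int[m]_x f x + b * \int[m]_x g x.
Proof.
move=> fi gi; rewrite RintegralD//.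
- by rewrite !RintegralZl.
- exact: (integrableZl measurableT a fi).
- exact: (integrableZl measurableT b gi).
Qed.

Lemma sqn_ge0 f : 0 <= sqn f.
Proof. by apply: Rintegral_ge0 => x _; rewrite sqr_ge0. Qed.

Lemma le_sqn f g : f \in L2 -> g \in L2 -> (forall x, `|f x| <= `|g x|) -> sqn f <= sqn g.
Proof.
move=> f2 g2 fg; apply: le_Rintegral => //; try exact: L2_sqr_integrable.
by move=> x _; rewrite -[f x ^+ 2]ger0_norm ?sqr_ge0// -[g x ^+ 2]ger0_norm ?sqr_ge0//
  !normrX ler_pXn2r// nnegrE.
Qed.

Lemma dotp_lin a b f g h : f \in L2 -> g \in L2 -> h \in L2 ->
  dotp (fun x => a * f x + b * g x) h = a * dotp f h + b * dotp g h.
Proof.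
move=> f2 g2 h2; rewrite /dotp -Rintegral_lin; try exact: L2_dot.
by apply: eq_Rintegral => x _; ring.
Qed.

Lemma sqn_lin a b f g : f \in L2 -> g \in L2 ->
  sqn (fun x => a * f x + b * g x) =
    a ^+ 2 * sqn f + 2 * a * b * dotp f g + b ^+ 2 * sqn g.
Proof.
move=> f2 g2; have fi := L2_sqr_integrable f2; have gi := L2_sqr_integrable g2.
have fgi := L2_dot f2 g2.
transitivity (\int[m]_x (1 * (a ^+ 2 * f x ^+ 2 + 2 * a * b * (f x * g x)) +
   b ^+ 2 * g x ^+ 2)).
  by apply: eq_Rintegral => x _; ring.
rewrite Rintegral_lin ?mul1r ?Rintegral_lin//.
exact: integrable_lin.
Qed.

Lemma sqnB_sym f g : sqn (fun x => f x - g x) = sqn (fun x => g x - f x).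
Proof. by apply: eq_Rintegral => x _; ring. Qed.

Lemma sqnD_le f g : f \in L2 -> g \in L2 ->
  sqn (fun x => f x + g x) <= 2 * sqn f + 2 * sqn g.
Proof.
move=> f2 g2; have := sqn_ge0 (fun x => 1 * f x + -1 * g x).
have -> : sqn (fun x => f x + g x) = sqn (fun x => 1 * f x + 1 * g x).
  by apply: eq_Rintegral => x _; rewrite !mul1r.
by rewrite !sqn_lin//; lra.
Qed.

Lemma sqnB_le f g h : f \in L2 -> g \in L2 -> h \in L2 ->
  sqn (fun x => f x - h x) <= 2 * sqn (fun x => f x - g x) + 2 * sqn (fun x => g x - h x).
Proof.
move=> f2 g2 h2; apply: le_trans (sqnD_le _ _); try exact: L2B.
by rewrite le_eqVlt; apply/orP; left; apply/eqP; apply: eq_Rintegral => x _; ring.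
Qed.

Lemma sqnZ a f : f \in L2 -> sqn (fun x => a * f x) = a ^+ 2 * sqn f.
Proof.
move=> f2; rewrite /sqn -RintegralZl//; last exact: L2_sqr_integrable.
by apply: eq_Rintegral => x _; rewrite exprMn.
Qed.

Lemma parallelogram f g : f \in L2 -> g \in L2 ->
  sqn (fun x => f x - g x) = 2 * sqn f + 2 * sqn g - 4 * sqn (fun x => 2^-1 * f x + 2^-1 * g x).
Proof.
move=> f2 g2; have -> : sqn (fun x => f x - g x) = sqn (fun x => 1 * f x + -1 * g x).
  by apply: eq_Rintegral => x _; ring.
by rewrite !sqn_lin//; field.
Qed.

(** The arithmetic-geometric form of Cauchy-Schwarz. *)
Lemma dotp_le t f g : 0 < t -> f \in L2 -> g \in L2 ->
  2 * `|dotp f g| <= t * sqn f + t^-1 * sqn g.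
Proof.
move=> t0 f2 g2.
have H (s : R) : s ^+ 2 = 1 -> 2 * (s * dotp f g) <= t * sqn f + t^-1 * sqn g.
  move=> s1; have := sqn_ge0 (fun x => t * f x + - s * g x); rewrite sqn_lin// sqrrN s1 => H.
  rewrite -(ler_pM2l t0) mulrDr !mulrA divff ?gt_eqF//; nra.
have [_|_] := ger0P (dotp f g).
- by have := H 1; rewrite expr1n mul1r; apply.
- by have := H (-1); rewrite mulN1r; apply; ring.
Qed.

Lemma EFin_sqn f : f \in L2 -> (sqn f)%:E = (\int[m]_x (f x ^+ 2)%:E)%E.
Proof.
move=> /L2_sqr_integrable f2; rewrite /sqn /Rintegral fineK//.
exact: integrable_fin_num.
Qed.

Lemma Lnorm2_sqn f : f \in L2 -> ('N[m]_2%:E[EFin \o f] = (Num.sqrt (sqn f))%:E)%E.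
Proof.
move=> f2; rewrite unlock -powR12_sqrt ?sqn_ge0// -poweR_EFin EFin_sqn//.
by congr (_ `^ _)%E; apply: eq_integral => x _ /=; rewrite powR_mulrn// -normrX ger0_norm ?sqr_ge0.
Qed.

Lemma sqn_eq0_ae f : f \in L2 -> sqn f = 0 -> {ae m, forall x, f x = 0}.
Proof.
move=> f2 f0; have mf := L2_measurable f2.
have : ('N[m]_2%:E[EFin \o f] = 0)%E by rewrite Lnorm2_sqn// f0 sqrtr0.
move/Lnorm_eq0_eq0; have /[swap]/[apply] : measurable_fun setT (EFin \o f) by exact/measurable_EFinP.
have two0 : (0 < 2%:E :> \bar R)%E by rewrite lte_fin.
by move=> /(_ two0); apply: filterS => x /= /(_ I) [].
Qed.

End square_integrable.

(** * Completeness *)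

Section L2_complete.
Context d (T : measurableType d) (R : realType) (m : probability T R).
Implicit Types f g h : T -> R.
Local Notation L2 := (Lfun m 2%:E).
Local Notation sqn := (sqn m).

(** Lower semicontinuity of the norm under a.e. convergence, by Fatou. *)
Lemma sqn_lsc (F : nat -> T -> R) f e N :
  (forall n, F n \in L2) -> measurable_fun setT f ->
  {ae m, forall x, F ^~ x @ \oo --> f x} ->
  (forall n, (N <= n)%N -> sqn (F n) <= e) ->
  f \in L2 /\ sqn f <= e.
Proof.
move=> F2 mf Ff Fe.
have mF n : measurable_fun setT (F n) := L2_measurable (F2 n).
have fatF : (\int[m]_x (f x ^+ 2)%:E <= e%:E)%E.
  apply: (@le_trans _ _ (\int[m]_x limn_einf (fun n => (F n x ^+ 2)%:E))%E).
    apply: ae_ge0_le_integral => //.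
    - by move=> x _; rewrite lee_fin sqr_ge0.
    - by apply/measurable_EFinP; exact: measurable_funX.
    - move=> x _; rewrite limn_einf_lim; apply: lime_ge; first exact: is_cvg_einfs.
      apply: nearW => n; apply: le_ereal_inf_tmp => _ [k _ <-].
      by rewrite lee_fin sqr_ge0.
    - apply: measurableT_comp => //; apply: measurable_fun_limn_esup => n.
      apply: measurableT_comp => //.
      by apply/measurable_EFinP; exact: measurable_funX.
    - apply: filterS Ff => x Fx _.
      have := @cvg_limn_einf_sup _ (fun n => (F n x ^+ 2)%:E) (f x ^+ 2)%:E.
      by case=> [|-> //]; apply: cvg_EFin; [exact: nearW|exact: cvgM].
  apply: le_trans (fatou _ _ _ _) _ => //.
  - by move=> n; apply/measurable_EFinP; exact: measurable_funX.
  - by move=> n x _; rewrite lee_fin sqr_ge0.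
  rewrite limn_einf_lim; apply: lime_le; first exact: is_cvg_einfs.
  exists N => // n /= Nn; apply: (@le_trans _ _ (\int[m]_x (F n x ^+ 2)%:E)%E).
    by apply: ereal_inf_lbound; exists n => /=.
  by rewrite -EFin_sqn// lee_fin Fe.
have f2 : f \in L2.
  apply/L2P; split => //; apply/integrableP; split.
    by apply/measurable_EFinP; exact: measurable_funX.
  apply: le_lt_trans (ltry e); apply: le_trans fatF.
  by under eq_integral do rewrite /= ger0_norm ?sqr_ge0//.
by split => //; rewrite -lee_fin EFin_sqn.
Qed.

Lemma telescope_cvg (u : nat -> R) C :
  (forall k, `|u k.+1 - u k| <= C * 2^-1 ^+ k) -> cvgn u.
Proof.
move=> uC; have -> : u = (fun n => u 0%N + series (telescope u) n).
  by apply/funext => n; exact: eq_sum_telescope.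
apply: is_cvgD; first exact: is_cvg_cst.
apply: normed_cvg; apply: (@series_le_cvg _ _ (geometric C 2^-1)) => // [n|n|].
- by rewrite /=.
- exact: le_trans (uC n).
- by apply: is_cvg_geometric_series; rewrite ger0_norm ?invf_lt1//; lra.
Qed.

(** A rapidly Cauchy sequence converges a.e.: the weighted series of its squared
    increments has a finite integral, hence is a.e. finite, and dominates the
    increments geometrically. *)
Lemma rapid_L2_cvg_ae (H : nat -> T -> R) :
  (forall k, H k \in L2) ->
  (forall k, sqn (fun x => H k.+1 x - H k x) <= 8^-1 ^+ k) ->
  {ae m, forall x, cvgn (H ^~ x)}.
Proof.
move=> H2 Hr; pose D k x := H k.+1 x - H k x.
have D2 k : D k \in L2 by apply: L2B.
pose W x := (\sum_(0 <= k <oo) (4 ^+ k * D k x ^+ 2)%:E)%E.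
have term0 k x : (0 <= (4 ^+ k * D k x ^+ 2)%:E)%E.
  by rewrite lee_fin mulr_ge0 ?sqr_ge0 ?exprn_ge0.
have mterm k : measurable_fun setT (fun x => (4 ^+ k * D k x ^+ 2)%:E).
  apply/measurable_EFinP; apply: measurable_funM => //.
  by apply: measurable_funX; exact: L2_measurable.
have W0 x : (0 <= W x)%E by apply: nneseries_ge0 => k _ _; exact: term0.
have iW : (\int[m]_x W x < +oo)%E.
  rewrite integral_nneseries//.
  apply: (@le_lt_trans _ _ (\sum_(0 <= k <oo) (2 / (2 ^ k.+1)%:R)%:E)%E).
    apply: lee_nneseries => [k _ _|k _]; first exact: integral_ge0.
    under eq_integral do rewrite EFinM.
    rewrite integralZl//; last exact: L2_sqr_integrable.
    rewrite -EFin_sqn// -EFinM lee_fin.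
    apply: le_trans (ler_wpM2l _ (Hr k)) _; first by rewrite exprn_ge0.
    rewrite -exprMn expnS natrM invfM mulrA divff// mul1r natrX -exprVn.
    by rewrite lerXn2r// ?nnegrE//; lra.
  by apply: le_lt_trans (epsilon_trick0 xpredT _) _; rewrite ?ltry.
have mW : measurable_fun setT W.
  rewrite (_ : W = (fun x => \sum_(0 <= k <oo | k \in xpredT) (4 ^+ k * D k x ^+ 2)%:E)%E).
    by apply: ge0_emeasurable_sum.
  by apply/funext => x; apply: eq_eseriesl.
have iWm : m.-integrable setT W.
  apply/integrableP; split => //.
  by under eq_integral do rewrite gee0_abs//.
apply: filterS (integrable_ae measurableT iWm) => x /(_ I) Wx.
apply: (@telescope_cvg _ (fine (W x) + 1)) => k.
have tk : 4 ^+ k * D k x ^+ 2 <= fine (W x).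
  rewrite -lee_fin fineK//; apply: (@le_trans _ _ (\sum_(0 <= i < k.+1) (4 ^+ i * D i x ^+ 2)%:E)%E).
    by rewrite big_nat_recr//= leeDr// sume_ge0.
  exact: nneseries_lim_ge.
have {}tk : (2 ^+ k * `|D k x|) ^+ 2 <= fine (W x).
  rewrite exprMn -normrX ger0_norm ?sqr_ge0// -exprM mulnC exprM.
  by rewrite (_ : 2 ^+ 2 = 4) ?tk//; ring.
have t0 : 0 <= 2 ^+ k * `|D k x| by rewrite mulr_ge0 ?exprn_ge0.
rewrite -/(D k x) exprVn ler_pdivlMr ?exprn_gt0// mulrC; nra.
Qed.

Lemma measurable_ae_limit (H : nat -> T -> R) :
  (forall k, measurable_fun setT (H k)) -> {ae m, forall x, cvgn (H ^~ x)} ->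
  exists2 f : T -> R, measurable_fun setT f & {ae m, forall x, H ^~ x @ \oo --> f x}.
Proof.
move=> mH [N [mN N0 HN]].
pose A := ~` N; have mA : measurable A by exact: measurableC.
have cA x : A x -> cvgn (H ^~ x).
  by move=> Ax; apply: contrapT => nc; apply: Ax; apply: HN.
pose K n x := H n x * \1_A x.
have cK x : cvgn (K ^~ x).
  have [Ax|Ax] := pselect (A x).
    rewrite (_ : K ^~ x = H ^~ x); first exact: cA.
    by apply/funext => n; rewrite /K indicE mem_set// mulr1.
  rewrite (_ : K ^~ x = cst 0); first exact: is_cvg_cst.
  by apply/funext => n; rewrite /K indicE memNset// mulr0.
exists (fun x => limn (K ^~ x)).
  apply: (@measurable_fun_cvg _ _ _ _ K) => [n|x _]; last exact: cK.
  by apply: measurable_funM => //; exact: measurable_indic.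
exists N; split => // x /= nx; apply: contrapT => Ax; apply: nx.
rewrite (_ : H ^~ x = K ^~ x); first exact: cK.
by apply/funext => n; rewrite /K indicE mem_set// mulr1.
Qed.

Lemma L2_complete (G : nat -> T -> R) : (forall n, G n \in L2) ->
  (forall e, 0 < e -> exists N, forall i j, (N <= i)%N -> (N <= j)%N ->
    sqn (fun x => G i x - G j x) <= e) ->
  exists2 f : T -> R, f \in L2 & forall e, 0 < e -> exists N, forall n, (N <= n)%N ->
    sqn (fun x => G n x - f x) <= e.
Proof.
move=> G2 GC.
have e8 k : (0 : R) < 8^-1 ^+ k by rewrite exprn_gt0// invr_gt0.
have [N HN] := choice (fun k => GC _ (e8 k)).
pose nk k := (\max_(i < k.+1) N i)%N.
have nkN k : (N k <= nk k)%N by rewrite /nk big_ord_recr/= leq_maxr.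
have nkS k : (nk k <= nk k.+1)%N by rewrite [nk k.+1]/nk big_ord_recr/= leq_maxl.
have nkle i j : (i <= j)%N -> (nk i <= nk j)%N.
  by apply: (homo_leq (r:=leq)) => //; exact: leq_trans.
have H2 k : G (nk k) \in L2 by [].
have cH := rapid_L2_cvg_ae H2 _.
have /cH{}cH : forall k, sqn (fun x => G (nk k.+1) x - G (nk k) x) <= 8^-1 ^+ k.
  by move=> k; apply: HN => //; exact: leq_trans (nkS k).
have [f mf Hf] := measurable_ae_limit (fun k => L2_measurable (H2 k)) cH.
have key k n : (nk k <= n)%N ->
   (fun x => G n x - f x) \in L2 /\ sqn (fun x => G n x - f x) <= 8^-1 ^+ k.
  move=> kn; apply: (@sqn_lsc (fun j x => G n x - G (nk j) x) _ _ k).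
  - by move=> j; apply: L2B.
  - by apply: measurable_funB => //; exact: L2_measurable.
  - by apply: filterS Hf => x Hx; apply: cvgB => //; exact: cvg_cst.
  - move=> j kj; apply: HN; first exact: leq_trans kn.
    by apply: (leq_trans (nkN k)); exact: nkle.
exists f.
  have [h _] := key 0%N (nk 0%N) (leqnn _).
  rewrite (_ : f = (fun x => G (nk 0%N) x - (G (nk 0%N) x - f x))).
    exact: L2B.
  by apply/funext => x; ring.
move=> e e0; have [k ke] : exists k, (8^-1 : R) ^+ k <= e.
  have /cvgrPdist_le/(_ _ e0)[k _ Hk] : (8^-1 : R) ^+ k @[k --> \oo] --> 0.
    by apply: cvg_expr; rewrite ger0_norm ?invf_lt1//; lra.
  exists k; have := Hk k (leqnn _); rewrite sub0r normrN ger0_norm ?exprn_ge0 ?invr_ge0//.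
by exists (nk k) => n kn; have [_ /le_trans] := key _ _ kn; apply.
Qed.

End L2_complete.

(** * Minimization over convex families *)

Section convex_minimization.
Context d (T : measurableType d) (R : realType) (m : probability T R).
Implicit Types f g h : T -> R.
Local Notation L2 := (Lfun m 2%:E).
Local Notation sqn := (sqn m).

Lemma harmonic_small (e : R) : 0 < e ->
  exists N, forall n, (N <= n)%N -> n.+1%:R^-1 <= e.
Proof.
move=> e0; have /cvgrPdist_le/(_ _ e0)[N _ HN] := @cvg_harmonic R.
exists N => n Nn; have := HN n Nn.
by rewrite /= sub0r normrN ger0_norm ?invr_ge0.
Qed.

Lemma le_sqn_ae f g : f \in L2 -> g \in L2 -> {ae m, forall x, `|f x| <= `|g x|} ->
  sqn f <= sqn g.
Proof.
move=> f2 g2 fg; rewrite -lee_fin !EFin_sqn//; apply: ae_ge0_le_integral => //.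
- by move=> x _; rewrite lee_fin sqr_ge0.
- by apply/measurable_EFinP; apply: measurable_funX; exact: (L2_measurable f2).
- by move=> x _; rewrite lee_fin sqr_ge0.
- by apply/measurable_EFinP; apply: measurable_funX; exact: (L2_measurable g2).
- apply: filterS fg => x fgx _; rewrite lee_fin.
  by rewrite -[f x ^+ 2]ger0_norm ?sqr_ge0// -[g x ^+ 2]ger0_norm ?sqr_ge0//
    !normrX ler_pXn2r// nnegrE.
Qed.

Lemma sqn_convex t e f g : 0 <= t <= 1 -> f \in L2 -> g \in L2 ->
  sqn f <= e -> sqn g <= e -> sqn (fun x => (1 - t) * f x + t * g x) <= e.
Proof.
move=> /andP[t0 t1] f2 g2; rewrite sqn_lin//.
have := dotp_le ltr01 f2 g2; rewrite mul1r invr1 mul1r.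
have := ler_norm (dotp m f g); move: (sqn f) (sqn g) (dotp m f g) => p q r rr rpq pe qe.
have : t * (1 - t) * (2 * r) <= t * (1 - t) * (p + q).
  by rewrite ler_wpM2l ?mulr_ge0 ?subr_ge0//; lra.
have : (1 - t) * p <= (1 - t) * e by rewrite ler_wpM2l ?subr_ge0.
have : t * q <= t * e by rewrite ler_wpM2l.
lra.
Qed.

(** Uniform in [f]: the threshold [r] is chosen before the member of an approximating
    sequence to which the lemma is applied. *)
Lemma sqnD_near (C e : R) : 0 < e -> exists2 r : R, 0 < r &
  forall f g, f \in L2 -> g \in L2 -> sqn f <= C -> sqn g <= r ->
  sqn (fun x => f x + g x) <= sqn f + e.
Proof.
move=> e0; have K0 : 0 < `|C| + 1 by rewrite ltr_wpDl.
pose t := e / 2 / (`|C| + 1); have t0 : 0 < t by rewrite !divr_gt0.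
have tC : t * (`|C| + 1) = e / 2 by rewrite /t mulfVK ?gt_eqF.
have T0 : 0 < 1 + t^-1 by rewrite ltr_wpDr// invr_ge0 ltW.
exists (e / 2 / (1 + t^-1)); first by rewrite !divr_gt0.
move=> f g f2 g2 fC; rewrite ler_pdivlMr// mulrDr mulr1 [_ * t^-1]mulrC => gr.
have -> : (fun x => f x + g x) = (fun x => 1 * f x + 1 * g x).
  by apply/funext => x; rewrite !mul1r.
rewrite sqn_lin// expr1n !mul1r mulr1.
have : t * sqn f <= e / 2.
  by rewrite -tC ler_pM2l//; have := ler_norm C; lra.
have := dotp_le t0 f2 g2; have := ler_norm (dotp m f g).
move: gr; move: (t * _) (t^-1 * _) => u v; lra.
Qed.

(** Almost minimal elements of a decreasing sequence of midpoint convex families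
    form a Cauchy sequence, by the parallelogram identity. The map [phi] need
    not be affine: it suffices that midpoints do not increase the norm. *)
Lemma min_norm_cvg (W : Type) (phi : W -> T -> R) (K : nat -> set W) M :
  (forall n w, K n w -> phi w \in L2) ->
  (forall n, K n.+1 `<=` K n) ->
  (forall n, exists2 w, K n w & sqn (phi w) <= M) ->
  (forall n a b, K n a -> K n b -> exists2 c, K n c &
    sqn (phi c) <= sqn (fun x => 2^-1 * phi a x + 2^-1 * phi b x)) ->
  exists (w : nat -> W) (f : T -> R), [/\ forall n, K n (w n), f \in L2,
    forall e, 0 < e -> exists N, forall n, (N <= n)%N ->
      sqn (fun x => phi (w n) x - f x) <= e &
    forall a, (forall n, K n a) -> sqn f <= sqn (phi a)].
Proof.
move=> K2 Kdec KM Kmid.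
have Kle i j : (i <= j)%N -> K j `<=` K i.
  by move=> /subnK <-; elim: (j - i)%N => // k IH; exact: subset_trans (Kdec _) IH.
pose S n := [set sqn (phi w) | w in K n].
have Sn0 n : S n !=set0 by have [w Kw _] := KM n; exists (sqn (phi w)), w.
have Slb n : has_lbound (S n) by exists 0 => _ [w _ <-]; exact: sqn_ge0.
have infle n w : K n w -> inf (S n) <= sqn (phi w).
  by move=> Kw; apply: ge_inf => //; exists w.
have infM n : inf (S n) <= M.
  by have [w Kw wM] := KM n; exact: le_trans (infle _ _ Kw) wM.
have infnd i j : (i <= j)%N -> inf (S i) <= inf (S j).
  move=> ij; apply: lb_le_inf => // _ [w Kw <-].
  by apply: infle; exact: Kle Kw.
have d0 n : (0 : R) < n.+1%:R^-1 by rewrite invr_gt0.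
have exw n : exists w : W, K n w /\ sqn (phi w) < inf (S n) + n.+1%:R^-1.
  have [_ [w Kw <-] lw] := inf_adherent (d0 n) (conj (Sn0 n) (Slb n)).
  by exists w.
have [w Hw] := choice exw.
have Kw n : K n (w n) by have [] := Hw n.
have w2 n : phi (w n) \in L2 by apply: K2 (Kw n).
pose E := sup (range (fun n => inf (S n))).
have EU : has_ubound (range (fun n => inf (S n))) by exists M => _ [n _ <-].
have leE n : inf (S n) <= E by apply: ub_le_sup => //; exists n.
have close n p : (n <= p)%N ->
    sqn (fun x => phi (w n) x - phi (w p) x) <= 2 * (E - inf (S n)) + 4 * n.+1%:R^-1.
  move=> np; rewrite parallelogram//.
  have [c Kc cle] := Kmid n _ _ (Kw n) (Kle _ _ np _ (Kw p)).
  have := le_trans (infle _ _ Kc) cle.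
  have [_ Hn] := Hw n; have [_ Hp] := Hw p; have := leE p.
  have : (p.+1%:R^-1 : R) <= n.+1%:R^-1 by rewrite lef_pV2 ?posrE// ler_nat.
  move: Hn Hp; move: (n.+1%:R^-1) (p.+1%:R^-1) (sqn (fun x => _ + _)) => dn dp q.
  lra.
have small e : 0 < e -> exists N, 2 * (E - inf (S N)) + 4 * N.+1%:R^-1 <= e.
  move=> e0.
  have e4 : 0 < e / 4 by lra.
  have [_ [N1 _ <-] HN1] := sup_adherent e4 (conj (ex_intro _ _ (ex_intro2 _ _ 0%N I erefl)) EU).
  have e8 : 0 < e / 8 by lra.
  have [N2 HN2] := harmonic_small e8.
  exists (maxn N1 N2).
  have := infnd _ _ (leq_maxl N1 N2).
  have := HN2 _ (leq_maxr N1 N2).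
  have {}HN1 : E - e / 4 < inf (S N1) := HN1.
  move: HN1 (_.+1%:R^-1) => HN1 dn; lra.
have [f f2 Hf] : exists2 f : T -> R, f \in L2 & forall e, 0 < e ->
    exists N, forall n, (N <= n)%N -> sqn (fun x => phi (w n) x - f x) <= e.
  apply: L2_complete => // e e0; have e4 : 0 < e / 4 by lra.
  have [N HN] := small _ e4; exists N => i j Ni Nj.
  apply: le_trans (sqnB_le (w2 i) (w2 N) (w2 j)) _.
  have hi := le_trans (close _ _ Ni) HN; have hj := le_trans (close _ _ Nj) HN.
  rewrite sqnB_sym in hi.
  by apply: le_trans (lerD (ler_wpM2l _ hi) (ler_wpM2l _ hj)) _ => //; lra.
exists w, f; split => // a Ka; apply/ler_addgt0Pr => e e0.
have e2 : 0 < e / 2 by lra.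
have [r r0 Hr] := sqnD_near (sqn (phi a) + 1) e2.
have [N HN] := Hf _ r0; have [N1 HN1] := harmonic_small ltr01.
have [N2 HN2] := harmonic_small e2.
pose n := maxn N (maxn N1 N2).
have Nn : (N <= n)%N := leq_maxl _ _.
have N1n : (N1 <= n)%N by rewrite leq_max leq_maxl orbT.
have N2n : (N2 <= n)%N by rewrite leq_max leq_maxr orbT.
have wn : sqn (phi (w n)) <= sqn (phi a) + n.+1%:R^-1.
  by have [_ /ltW/le_trans] := Hw n; apply; rewrite lerD2r infle.
have -> : f = (fun x => phi (w n) x + (f x - phi (w n) x)).
  by apply/funext => x; ring.
have fw : sqn (fun x => f x - phi (w n) x) <= r by rewrite sqnB_sym; exact: HN.
have w1 : sqn (phi (w n)) <= sqn (phi a) + 1.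
  by apply: le_trans wn _; rewrite lerD2l; exact: HN1.
have w2e : sqn (phi (w n)) <= sqn (phi a) + e / 2.
  by apply: le_trans wn _; rewrite lerD2l; exact: HN2.
apply: le_trans (Hr _ _ (w2 n) (L2B f2 (w2 n)) w1 fw) _.
by move: w2e; clear; lra.
Qed.

End convex_minimization.

(** * Strong gradients *)

Section strong_gradients.
Context {R : realType} {d : measure_display} {X : borelMetricType R d}.
Variable m : probability X R.
Hypothesis compactX : compact [set: X].
Implicit Types (f g h u v w : X -> R) (x y : X) (e : R).
Local Notation L2 := (Lfun m 2%:E).
Local Notation sqn := (sqn m).

Lemma lipschitz_L2 w : is_lipschitz w -> w \in L2.
Proof.
move=> Lw; have [M _ wM] := compact_lipschitz_bounded compactX Lw.
exact: L2_bounded (measurable_lipschitz Lw) wM.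
Qed.

Lemma lip_L2 w : is_lipschitz w -> lip w \in L2.
Proof.
move=> Lw; have [C C0 wC] := is_lipschitzW Lw.
apply: (@L2_bounded _ _ _ _ _ C); first exact: measurable_lip.
by move=> x; rewrite ger0_norm ?lip_ge0//; exact: lip_le.
Qed.

(** The positive part of [f - g] is dominated by the sum of the two errors. *)
Lemma ae_le_closed f g : f \in L2 -> g \in L2 ->
  (forall e, 0 < e -> exists a b : X -> R, [/\ a \in L2, b \in L2,
    sqn (fun x => f x - a x) <= e, {ae m, forall x, a x <= b x} &
    sqn (fun x => b x - g x) <= e]) ->
  {ae m, forall x, f x <= g x}.
Proof.
move=> f2 g2 H; pose p x := Num.max (f x - g x) 0.
have mp : measurable_fun setT p.
  by apply: measurable_maxr => //; exact: L2_measurable (L2B f2 g2).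
have p2 : p \in L2.
  apply: L2_le mp _ (L2B f2 g2) => x; rewrite /p.
  by have [|] := leP (f x - g x) 0; rewrite ?normr0.
have p0 : sqn p = 0.
  apply/eqP; rewrite eq_le sqn_ge0 andbT; apply/ler_addgt0Pr => e e0; rewrite add0r.
  have e4 : 0 < e / 4 by lra.
  have [a [b [a2 b2 fa ab bg]]] := H _ e4.
  apply: le_trans (_ : sqn (fun x => (f x - a x) + (b x - g x)) <= _).
    apply: le_sqn_ae => //; first by apply: L2D; apply: L2B.
    apply: filterS ab => x abx; rewrite /p.
    have [fg|fg] := leP (f x - g x) 0; first by rewrite normr0.
    by rewrite !gtr0_norm//; lra.
  apply: le_trans (sqnD_le _ _) _; [exact: L2B..|lra].
apply: filterS (sqn_eq0_ae p2 p0) => x; rewrite /p => px.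
have := le_max (f x - g x) (f x - g x) 0; rewrite px lexx/=; lra.
Qed.

(** Both approximations are in norm. Unlike the weak convergence defining relaxed
    gradients, this is visibly convex and closed; the two notions turn out to
    agree. *)
Definition strong_gradient f h := forall e, 0 < e ->
  exists w G, [/\ is_lipschitz w, G \in L2, sqn (fun x => w x - f x) <= e,
    {ae m, forall x, lip w x <= G x} & sqn (fun x => G x - h x) <= e].

Lemma strong_gradient_ge0 f h : h \in L2 -> strong_gradient f h ->
  {ae m, forall x, 0 <= h x}.
Proof.
move=> h2 fh; apply: (@ae_le_closed (cst 0)) => //; first exact: Lfun_cst.
move=> e e0; have [w [G [Lw G2 _ wG Gh]]] := fh _ e0.
exists (cst 0), G; split => //; first exact: Lfun_cst.
  rewrite (_ : sqn _ = 0) ?ltW// /sqn.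
  under eq_Rintegral do rewrite subrr expr0n.
  by rewrite Rintegral_cst// mul0r.
by apply: filterS wG => x; apply: le_trans; exact: lip_ge0.
Qed.

Lemma strong_gradient_closed f h : h \in L2 ->
  (forall e, 0 < e -> exists h', [/\ h' \in L2, strong_gradient f h' &
    sqn (fun x => h' x - h x) <= e]) -> strong_gradient f h.
Proof.
move=> h2 H e e0; have e4 : 0 < e / 4 by lra.
have [h' [h'2 fh' h'h]] := H _ e4; have [w [G [Lw G2 wf wG Gh']]] := fh' _ e4.
exists w, G; split => //; first by lra.
apply: le_trans (sqnB_le G2 h'2 h2) _; lra.
Qed.

(** By the Leibniz inequality the error of the glued functions involves
    [L * `|u - v|], whose norm is small since [u] and [v] both approximate [f]. *)
Lemma strong_gradient_interpolation f h1 h2 chi L :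
  0 <= L -> lipschitz_with L chi -> (forall x, 0 <= chi x <= 1) ->
  f \in L2 -> h1 \in L2 -> h2 \in L2 ->
  strong_gradient f h1 -> strong_gradient f h2 ->
  strong_gradient f (fun x => (1 - chi x) * h1 x + chi x * h2 x).
Proof.
move=> L0 chiL chi01 f2 h12 h22 fh1 fh2 e e0.
have K0 : 0 < 4 + 8 * L ^+ 2 by rewrite ltr_wpDr ?mulr_ge0 ?sqr_ge0.
pose e' := e / 2 / (4 + 8 * L ^+ 2); have e'0 : 0 < e' by rewrite !divr_gt0.
have e'e : e' * (4 + 8 * L ^+ 2) = e / 2 by rewrite mulfVK ?gt_eqF.
have e'e0 : 0 <= e' * L ^+ 2 by rewrite mulr_ge0 ?sqr_ge0 ?ltW.
have [u [G [Lu G2 uf uG Gh]]] := fh1 _ e'0.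
have [v [J [Lv J2 vf vJ Jh]]] := fh2 _ e'0.
have u2 := lipschitz_L2 Lu; have v2 := lipschitz_L2 Lv.
have mchi : measurable_fun setT chi by apply: measurable_lipschitz; exists L.
(* The weights are at most [1], so only the cross terms cost a factor [2]. *)
have comb a b : a \in L2 -> b \in L2 ->
    (fun x => (1 - chi x) * a x + chi x * b x) \in L2 /\
    sqn (fun x => (1 - chi x) * a x + chi x * b x) <= 2 * sqn a + 2 * sqn b.
  move=> a2 b2.
  have ca : (fun x => (1 - chi x) * a x) \in L2.
    apply: (L2_le _ _ a2) => [|x].
      by apply: measurable_funM; [exact: measurable_funB|exact: L2_measurable a2].
    have /andP[c0 c1] := chi01 x.
    by rewrite normrM ger0_norm ?subr_ge0// ler_piMl//; lra.
  have cb : (fun x => chi x * b x) \in L2.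
    apply: (L2_le _ _ b2) => [|x].
      by apply: measurable_funM => //; exact: L2_measurable b2.
    have /andP[c0 c1] := chi01 x.
    by rewrite normrM ger0_norm// ler_piMl.
  split; first exact: L2D.
  apply: le_trans (sqnD_le ca cb) _; apply: lerD; rewrite ler_pM2l//;
    apply: le_sqn => // x; have /andP[c0 c1] := chi01 x.
    by rewrite normrM ger0_norm ?subr_ge0// ler_piMl//; lra.
  by rewrite normrM ger0_norm// ler_piMl.
have [Lw lw] := lip_interpolation compactX L0 chiL chi01 Lu Lv.
have [GJ2 _] := comb _ _ G2 J2.
have uv2 : (fun x => L * `|u x - v x|) \in L2.
  apply: L2Z; apply: (L2_le _ _ (L2B u2 v2)) => [|x]; last by rewrite normr_id.
  by apply: measurableT_comp => //; apply: measurable_funB; exact: measurable_lipschitz.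
have uv : sqn (fun x => L * `|u x - v x|) <= 4 * e' * L ^+ 2.
  rewrite sqnZ; last first.
    apply: (L2_le _ _ (L2B u2 v2)) => [|x]; last by rewrite normr_id.
    by apply: measurableT_comp => //; apply: measurable_funB; exact: measurable_lipschitz.
  rewrite mulrC ler_wpM2r ?sqr_ge0//.
  rewrite (_ : sqn _ = sqn (fun x => u x - v x)); last first.
    by apply: eq_Rintegral => x _; rewrite -normrX ger0_norm ?sqr_ge0.
  by apply: le_trans (sqnB_le u2 f2 v2) _; rewrite [X in _ + _ * X]sqnB_sym; lra.
exists (fun x => (1 - chi x) * u x + chi x * v x).
exists (fun x => ((1 - chi x) * G x + chi x * J x) + L * `|u x - v x|).
split => //.
- exact: L2D.
- rewrite (_ : (fun x => _) = (fun x => (1 - chi x) * (u x - f x) + chi x * (v x - f x))).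
    have [_ /le_trans] := comb _ _ (L2B u2 f2) (L2B v2 f2); apply.
    by nra.
  by apply/funext => x; ring.
- apply: filterS2 uG vJ => x uGx vJx.
  apply: le_trans (lw x) _.
  by have /andP[c0 c1] := chi01 x; rewrite lerD2r lerD// ler_wpM2l//; lra.
- rewrite (_ : (fun x => _) = (fun x => ((1 - chi x) * (G x - h1 x) + chi x * (J x - h2 x))
     + L * `|u x - v x|)); last by apply/funext => x; ring.
  have [c2 cle] := comb _ _ (L2B G2 h12) (L2B J2 h22).
  by apply: le_trans (sqnD_le c2 uv2) _; nra.
Qed.

End strong_gradients.

(** * Strong gradients and relaxed gradients coincide *)

Section relaxed_gradients.
Context {R : realType} {d : measure_display} {X : borelMetricType R d}.
Variable m : probability X R.
Hypothesis compactX : compact [set: X].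
Implicit Types (f g h u v w : X -> R) (x y : X) (e : R).
Local Notation L2 := (Lfun m 2%:E).
Local Notation sqn := (sqn m).

(** A strong gradient is a relaxed one: among the Lipschitz functions that nearly
    realize [h], those of almost minimal [lip]-norm have slopes [lip w] that
    converge in norm, to a limit bounded by [h]. *)
Lemma strong_gradient_relaxed f h : f \in L2 -> h \in L2 ->
  strong_gradient m f h -> relaxed_gradient m f h.
Proof.
move=> f2 h2 fh; split => //.
pose K n w := is_lipschitz w /\ sqn (fun x => w x - f x) <= n.+1%:R^-1 /\
  exists G : X -> R, [/\ G \in L2, {ae m, forall x, lip w x <= G x} &
    sqn (fun x => G x - h x) <= n.+1%:R^-1].
have inv0 n : (0 : R) < n.+1%:R^-1 by rewrite invr_gt0.
have invS n : (n.+2%:R^-1 : R) <= n.+1%:R^-1 by rewrite lef_pV2 ?posrE// ler_nat.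
have inv1 n : (n.+1%:R^-1 : R) <= 1 by rewrite invf_le1// ler1n.
have [||||u [l [Ku l2 ul _]]] := @min_norm_cvg _ _ _ m _ (@lip R d X) K (2 + 2 * sqn h).
- by move=> n w [Lw _]; exact: lip_L2.
- move=> n w [Lw [wf [G [G2 wG Gh]]]]; split => //; split; first exact: le_trans (invS n).
  by exists G; split => //; exact: le_trans (invS n).
- move=> n; have [w [G [Lw G2 wf wG Gh]]] := fh _ (inv0 n).
  exists w; first by split => //; split => //; exists G.
  apply: (@le_trans _ _ (sqn G)).
    apply: le_sqn_ae => //; first exact: lip_L2.
    apply: filterS wG => x; rewrite ger0_norm ?lip_ge0// => /le_trans; apply.
    exact: ler_norm.
  have -> : G = (fun x => (G x - h x) + h x) by apply/funext => x; ring.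
  apply: le_trans (sqnD_le (L2B G2 h2) h2) _; rewrite lerD2r.
  by have := le_trans Gh (inv1 n); lra.
- move=> n a b [La [af [G [G2 aG Gh]]]] [Lb [bf [J [J2 bJ Jh]]]].
  have h01 : 0 <= (2^-1 : R) <= 1.
    by rewrite invr_ge0 ler0n invf_le1 ?ler1n.
  have half0 : lipschitz_with 0 (fun _ : X => 2^-1 : R) .
    by move=> x y; rewrite subrr normr0 mul0r.
  have [Lc lc] := lip_interpolation compactX (lexx 0) half0 (fun=> h01) La Lb.
  have mid2 s t : s \in L2 -> t \in L2 ->
      (fun x => (1 - 2^-1) * s x + 2^-1 * t x) \in L2.
    by move=> s2 t2; apply: L2D; apply: L2Z.
  have a2 := lipschitz_L2 m compactX La; have b2 := lipschitz_L2 m compactX Lb.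
  exists (fun x => (1 - 2^-1) * a x + 2^-1 * b x).
    split => //; split.
      rewrite (_ : (fun x => _) = (fun x => (1 - 2^-1) * (a x - f x) + 2^-1 * (b x - f x))).
        by apply: sqn_convex => //; exact: L2B.
      by apply/funext => x; field.
    exists (fun x => (1 - 2^-1) * G x + 2^-1 * J x); split; first exact: mid2.
      apply: filterS2 aG bJ => x ax bx; apply: le_trans (lc x) _.
      by rewrite mul0r addr0; clear -ax bx; lra.
    rewrite (_ : (fun x => _) = (fun x => (1 - 2^-1) * (G x - h x) + 2^-1 * (J x - h x))).
      by apply: sqn_convex => //; exact: L2B.
    by apply/funext => x; field.
  apply: le_sqn; [exact: lip_L2| |].
    by apply: L2D; apply: L2Z; exact: lip_L2.
  move=> x; have la := lip_ge0 x La; have lb := lip_ge0 x Lb.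
  rewrite ger0_norm ?lip_ge0// ger0_norm; last by clear -la lb; lra.
  by apply: le_trans (lc x) _; rewrite mul0r addr0; clear; lra.
have Lu n : is_lipschitz (u n) by have [] := Ku n.
have lu2 n : lip (u n) \in L2 by exact: lip_L2.
exists u, l; split => //.
- rewrite (_ : (fun n => _) = (fun n => (Num.sqrt (sqn (fun x => u n x - f x)))%:E)); last first.
    apply/funext => n; rewrite -Lnorm2_sqn//.
    by apply: L2B => //; exact: lipschitz_L2.
  apply: cvg_EFin; first exact: nearW.
  apply/cvgrPdist_le => e e0; have e20 : 0 < e ^+ 2 by rewrite exprn_gt0.
  have [N HN] := harmonic_small e20; exists N => // n /= Nn.
  rewrite sub0r normrN ger0_norm ?sqrtr_ge0//.
  have -> : e = Num.sqrt (e ^+ 2) by rewrite sqrtr_sqr gtr0_norm.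
  by apply: ler_wsqrtr; have [_ [un _]] := Ku n; exact: le_trans un (HN n Nn).
- split => // g g2.
  apply/cvgrPdist_le => e e0.
  pose t := (sqn g + 1) / e; have t0 : 0 < t by rewrite divr_gt0// ltr_wpDl// sqn_ge0.
  have e1 : 0 < e / t by rewrite divr_gt0.
  have [N HN] := ul _ e1; exists N => // n /= Nn.
  have nl2 : (fun x => lip (u n) x - l x) \in L2 by apply: L2B.
  have -> : \int[m]_x (l x * g x) - \int[m]_x (lip (u n) x * g x) =
      - dotp m (fun x => 1 * lip (u n) x + -1 * l x) g.
    by rewrite dotp_lin// /dotp; ring.
  rewrite normrN.
  have -> : (fun x => 1 * lip (u n) x + -1 * l x) = (fun x => lip (u n) x - l x).
    by apply/funext => x; ring.
  have := dotp_le t0 nl2 g2; have := HN n Nn; rewrite ler_pdivlMr// mulrC => H1.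
  have : t^-1 * sqn g <= e.
    rewrite invf_div mulrAC ler_pdivrMr ?ltr_wpDl ?sqn_ge0// ler_pM2l//; lra.
  move: H1; move: (t * _) (t^-1 * _) => a b; lra.
- apply: ae_le_closed => // e e0.
  have [N HN] := ul _ e0; have [N2 HN2] := harmonic_small e0.
  pose n := maxn N N2; have [_ [_ [G [G2 uG Gh]]]] := Ku n.
  exists (lip (u n)), G; split => //.
    by rewrite sqnB_sym; apply: HN; exact: leq_maxl.
  by apply: le_trans Gh _; apply: HN2; exact: leq_maxr.
Qed.

(** Conversely, by Mazur's argument: the projection of the weak limit [h'] onto
    the closed convex set of strongly realizable majorants must be [h'] itself,
    because it minimizes the distance to all the slopes [lip (u n)], which
    converge weakly to [h']. *)
Lemma relaxed_gradient_strong f h : relaxed_gradient m f h -> strong_gradient m f h.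
Proof.
move=> [f2 h2 [u [h' [Lu uf [lu2 h'2 weak] h'h]]]] e e0.
pose K (G : X -> R) := G \in L2 /\ exists w, [/\ is_lipschitz w,
  sqn (fun x => w x - f x) <= e & {ae m, forall x, lip w x <= G x}].
have u2 n : u n \in L2 by exact: lipschitz_L2.
have [N HN] : exists N, forall n, (N <= n)%N -> K (lip (u n)).
  have se : 0 < Num.sqrt e by rewrite sqrtr_gt0.
  move: uf; rewrite (_ : (fun n => _) = (fun n => (Num.sqrt (sqn (fun x => u n x - f x)))%:E)); last first.
    by apply/funext => n; rewrite -Lnorm2_sqn//; exact: L2B.
  move=> /fine_cvgP[_] /cvgrPdist_le/(_ _ se)[N _ HN]; exists N => n Nn.
  split; first exact: lu2.
  exists (u n); split => //; last by apply/nearW.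
  have := HN n Nn; rewrite /= sub0r normrN ger0_norm ?sqrtr_ge0//.
  by rewrite ler_sqrt// ltW.
have Kconv t a b : 0 <= t <= 1 -> K a -> K b -> K (fun x => (1 - t) * a x + t * b x).
  move=> /andP[t0 t1] [a2 [v [Lv vf va]]] [b2 [w [Lw wf wb]]].
  split; first by apply: L2D; apply: L2Z.
  have t01 (x : X) : 0 <= (fun=> t) x <= 1 by move=> /=; rewrite t0.
  have tl : lipschitz_with 0 (fun _ : X => t) .
    by move=> x y; rewrite subrr normr0 mul0r.
  have [Lc lc] := lip_interpolation compactX (lexx 0) tl t01 Lv Lw.
  exists (fun x => (1 - t) * v x + t * w x); split => //.
    have v2 := lipschitz_L2 m compactX Lv; have w2 := lipschitz_L2 m compactX Lw.
    rewrite (_ : (fun x => _) = (fun x => (1 - t) * (v x - f x) + t * (w x - f x))).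
      by apply: sqn_convex => //; [rewrite t0|exact: L2B..].
    by apply/funext => x; ring.
  apply: filterS2 va wb => x vx wx; apply: le_trans (lc x) _.
  by rewrite mul0r addr0 lerD// ler_wpM2l// subr_ge0.
have [||||G [q [KG q2 Gq qmin]]] := @min_norm_cvg _ _ _ m _
  (fun G x => G x - h' x) (fun=> K) (sqn (fun x => lip (u N) x - h' x)).
- by move=> _ a [a2 _]; exact: L2B.
- by move=> n.
- by move=> n; exists (lip (u N)) => //; exact: HN.
- move=> n a b Ka Kb; exists (fun x => (1 - 2^-1) * a x + 2^-1 * b x).
    by apply: Kconv => //; rewrite invr_ge0 ler0n invf_le1 ?ler1n.
  by rewrite le_eqVlt; apply/orP; left; apply/eqP; apply: eq_Rintegral => x _; field.
(* [q] is the shortest vector from [h'] to the closure of [K]; moving slightly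
   from [q] towards [y - h'] within that convex set does not shorten it. *)
have var (y : X -> R) : K y -> sqn q <= dotp m (fun x => y x - h' x) q.
  move=> Ky; have [y2 _] := Ky.
  have yh2 : (fun x => y x - h' x) \in L2 by exact: L2B.
  apply/ler_addgt0Pr => s s0.
  pose C := sqn (fun x => -1 * q x + 1 * (y x - h' x)) + 1.
  have C0 : 0 < C by rewrite ltr_wpDl// sqn_ge0.
  pose t := Num.min 1 (s / C).
  have t0 : 0 < t by rewrite lt_min ltr01 divr_gt0.
  have t1 : t <= 1 by rewrite ge_min lexx.
  have tC : t * C <= s by rewrite -ler_pdivlMr// ge_min lexx orbT.
  have tlow : sqn q <= sqn (fun x => (1 - t) * q x + t * (y x - h' x)).
    apply/ler_addgt0Pr => r r0.
    have [z z0 Hz] := sqnD_near m (sqn (fun x => (1 - t) * q x + t * (y x - h' x))) r0.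
    have [N1 HN1] := Gq _ z0; pose g x := G N1 x - h' x - q x.
    have Hg : sqn g <= z := HN1 _ (leqnn _).
    have [G2 _] := KG N1.
    have g2 : g \in L2 by apply: L2B => //; exact: L2B.
    have := qmin (fun x => (1 - t) * G N1 x + t * y x).
    have /[swap]/[apply] : forall n : nat, K (fun x => (1 - t) * G N1 x + t * y x).
      by move=> _; apply: Kconv => //; rewrite (ltW t0).
    move=> /le_trans; apply.
    have q'2 : (fun x => (1 - t) * q x + t * (y x - h' x)) \in L2.
      by apply: L2D; apply: L2Z.
    rewrite (_ : (fun x => _) = (fun x => ((1 - t) * q x + t * (y x - h' x)) + (1 - t) * g x));
      last by apply/funext => x; rewrite /g; ring.
    apply: Hz => //; first exact: L2Z.
    rewrite sqnZ//; apply: le_trans Hg; rewrite ler_piMl ?sqn_ge0//.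
    by rewrite expr_le1// ?subr_ge0// gerBl ltW.
  have e1 : (fun x => (1 - t) * q x + t * (y x - h' x)) =
      (fun x => 1 * q x + t * (-1 * q x + 1 * (y x - h' x))).
    by apply/funext => x; ring.
  have d2 : (fun x => -1 * q x + 1 * (y x - h' x)) \in L2 by apply: L2D; apply: L2Z.
  move: tlow; rewrite e1 sqn_lin// expr1n mul1r.
  have -> : dotp m q (fun x => -1 * q x + 1 * (y x - h' x)) =
      - sqn q + dotp m (fun x => y x - h' x) q.
    transitivity (dotp m (fun x => -1 * q x + 1 * (y x - h' x)) q).
      by apply: eq_Rintegral => x _; ring.
    have qq : dotp m q q = sqn q by apply: eq_Rintegral => x _; rewrite expr2.
    by rewrite dotp_lin// qq mul1r mulN1r.
  have : sqn (fun x => -1 * q x + 1 * (y x - h' x)) <= C by rewrite lerDl.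
  have := sqn_ge0 m (fun x => -1 * q x + 1 * (y x - h' x)).
  move: (sqn _) (dotp _ _ _) => a b a0 aC.
  move=> H; have : 0 <= 2 * t * (- sqn q + b) + t * (t * a) by lra.
  have : t * (t * a) <= t * s.
    by rewrite ler_pM2l//; apply: le_trans tC; rewrite ler_pM2l.
  move=> H1 H2; have : 0 <= t * (2 * (- sqn q + b) + s) by lra.
  by rewrite pmulr_rge0//; lra.
have q0 : sqn q = 0.
  apply/eqP; rewrite eq_le sqn_ge0 andbT.
  have cv : dotp m (fun x => lip (u n) x - h' x) q @[n --> \oo] --> 0.
    rewrite (_ : (fun n => _) = (fun n => \int[m]_x (lip (u n) x * q x) - \int[m]_x (h' x * q x))).
      by rewrite -(subrr (\int[m]_x (h' x * q x))); apply: cvgB; [exact: weak|exact: cvg_cst].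
    apply/funext => n; rewrite -RintegralB//; [|exact: L2_dot..].
    by apply: eq_Rintegral => x _; ring.
  apply: (cvgr_to_ge cv); exists N => // n /= Nn; apply: var; exact: HN.
have e4 : 0 < e / 4 by lra.
have [N1 HN1] := Gq _ e4; have := HN1 _ (leqnn _).
have [G2 [w [Lw wf wG]]] := KG N1 => Hq.
exists w, (fun x => G N1 x + (h x - h' x)); split => //.
- by apply: L2D => //; exact: L2B.
- by apply: filterS2 wG h'h => x; lra.
- rewrite (_ : (fun x => _) = (fun x => (G N1 x - h' x - q x) + q x)).
    apply: le_trans (sqnD_le _ _) _ => //; first by apply: L2B => //; exact: L2B.
    by rewrite q0; lra.
  by apply/funext => x; ring.
Qed.

End relaxed_gradients.

(** * Density of Lipschitz cutoffs *)

Section density.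
Context {R : realType} {d : measure_display} {X : borelMetricType R d}.
Variable m : probability X R.
Implicit Types (f g h u v w : X -> R) (x y : X) (e : R).

Lemma Rintegral_dominated_small (F : nat -> X -> R) psi e : 0 < e ->
  m.-integrable setT (EFin \o psi) -> (forall n, measurable_fun setT (F n)) ->
  (forall n x, `|F n x| <= psi x) -> (forall x, F ^~ x @ \oo --> 0) ->
  exists n, \int[m]_x F n x <= e.
Proof.
move=> e0 ipsi mF Fpsi F0.
have [|||||_ _] := @dominated_convergence _ _ _ m _ measurableT (fun n => EFin \o F n) (cst 0%E) (EFin \o psi).
- by move=> n; exact/measurable_EFinP.
- by [].
- by apply: nearW => x _; apply: cvg_EFin; [exact: nearW|exact: F0].
- by [].
- by apply: nearW => x n _ /=; rewrite lee_fin.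
rewrite integral0 => /fine_cvgP[_ /cvgrPdist_le/(_ _ e0)[N _ HN]].
exists N; have := HN N (leqnn _); rewrite /= sub0r normrN => /(le_trans (ler_norm _)); exact.
Qed.

Lemma eventually0_cvg (u : nat -> R) N : (forall n, (N <= n)%N -> u n = 0) ->
  u @ \oo --> 0.
Proof.
move=> uN; apply/cvgrPdist_le => e e0; exists N => // n /= Nn.
by rewrite uN// subrr normr0 ltW.
Qed.

Definition lipschitz_cutoff (chi : X -> R) :=
  is_lipschitz chi /\ forall x, 0 <= chi x <= 1.

Lemma dist_set_lipschitz (A : set X) : A !=set0 ->
  lipschitz_with 1 (fun x => inf [set mdist x y | y in A]).
Proof.
move=> [a Aa] x y; rewrite mul1r.
have H z t : inf [set mdist z y | y in A] <= mdist z t + inf [set mdist t y | y in A].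
  rewrite -lerBlDl; apply: lb_le_inf; first by exists (mdist t a), a.
  move=> _ [b Ab <-]; rewrite lerBlDl; apply: le_trans (metric_triangle z t b).
  by apply: ge_inf; [exists 0 => _ [c _ <-]; exact: mdist_ge0|exists b].
have := H x y; have := H y x; rewrite (metric_sym y x) ler_norml.
by move: (inf _) (inf _) => p q; lra.
Qed.

Variable psi : X -> R.
Hypothesis psi0 : forall x, 0 <= psi x.
Hypothesis ipsi : m.-integrable setT (EFin \o psi).

(** The weight [psi] stands for an arbitrary integrable density. The class is shown
    to be a sigma-algebra containing the open sets. *)
Definition cutoff_approximable (B : set X) := measurable B /\ forall e, 0 < e ->
  exists2 chi, lipschitz_cutoff chi & \int[m]_x (`|chi x - \1_B x| * psi x) <= e.

Let mpsi : measurable_fun setT psi.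
Proof. by apply/measurable_EFinP; exact: measurable_int ipsi. Qed.

Let weighted_integrable (F : X -> R) : measurable_fun setT F ->
  (forall x, `|F x| <= 1) -> m.-integrable setT (EFin \o (fun x => `|F x| * psi x)).
Proof.
move=> mF F1; apply: (le_integrable measurableT _ _ ipsi).
  apply/measurable_EFinP; apply: measurable_funM => //.
  exact: measurableT_comp.
move=> x _ /=; rewrite lee_fin normrM normr_id (ger0_norm (psi0 x)).
by rewrite ler_piMl.
Qed.

Lemma cutoff_indic_dist chi B x : lipschitz_cutoff chi -> `|chi x - \1_B x| <= 1.
Proof.
move=> [_ /(_ x)/andP[c0 c1]]; rewrite indicE ler_norml.
by case: (x \in B) => /=; lra.
Qed.

Lemma measurable_cutoff_diff chi B : lipschitz_cutoff chi -> measurable B ->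
  measurable_fun setT (fun x => chi x - \1_B x).
Proof.
move=> [Lc _] mB; apply: measurable_funB; first exact: measurable_lipschitz.
exact: measurable_indic.
Qed.

(** The truncated multiples [min 1 (n * dist (x, ~` A))] increase to the indicator
    of [A]. *)
Lemma cutoff_approximable_open (A : set X) : open A -> cutoff_approximable A.
Proof.
move=> oA; have mA : measurable A by exact: open_measurable_borel.
split => // e e0.
have [cA0|cA0] := pselect (~` A !=set0); last first.
  have -> : A = setT.
    by apply/seteqP; split => // x _; apply: contrapT => Ax; apply: cA0; exists x.
  exists (cst 1); first by split; [exists 0 => x y; rewrite subrr normr0 mul0r|move=> x /=; lra].
  rewrite (_ : (fun x => _) = cst 0); last first.
    by apply/funext => x; rewrite indicT subrr normr0 mul0r.
  by rewrite Rintegral_cst// mul0r ltW.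
pose dl x := inf [set mdist x y | y in ~` A].
have dl1 : lipschitz_with 1 dl by exact: dist_set_lipschitz.
have lb x : has_lbound [set mdist x y | y in ~` A] by exists 0 => _ [y _ <-]; exact: mdist_ge0.
have dl0 x : 0 <= dl x.
  by apply: lb_le_inf => [|_ [y _ <-]]; [have [a Aa] := cA0; exists (mdist x a), a|exact: mdist_ge0].
have dlA x : A x -> 0 < dl x.
  move=> Ax; have /nbhs_ballP[r /= r0 rA] := open_nbhs_nbhs (conj oA Ax).
  apply: lt_le_trans r0 _; apply: lb_le_inf; first by have [a Aa] := cA0; exists (mdist x a), a.
  move=> _ [y Ay <-]; rewrite leNgt; apply/negP => xy; apply: Ay; apply: rA.
  by rewrite ballEmdist.
have dlNA x : ~ A x -> dl x = 0.
  move=> Ax; apply/eqP; rewrite eq_le dl0 andbT -(mdistxx x).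
  by apply: ge_inf => //; exists x.
pose chi n x := Num.min 1 (n%:R * dl x).
have cut n : lipschitz_cutoff (chi n).
  split; last by move=> x; rewrite le_min ler01 mulr_ge0//= ge_min lexx.
  exists n%:R => x y; have := dl1 x y; rewrite mul1r => xy.
  apply: le_trans (_ : n%:R * `|dl x - dl y| <= _); last by rewrite ler_wpM2l.
  rewrite -[X in X * _]ger0_norm// -normrM mulrBr /chi.
  move: (n%:R * dl x) (n%:R * dl y) => p q.
  by have [?|?] := leP 1 p; have [?|?] := leP 1 q; rewrite ?subrr ?normr0//;
    rewrite ler_norml; have := ler_norm (p - q); have := ler_norm (- (p - q)); rewrite normrN; lra.
have [|||n Hn] := @Rintegral_dominated_small (fun n x => `|chi n x - \1_A x| * psi x) psi _ e0 ipsi.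
- move=> n; apply: measurable_funM => //; apply: measurableT_comp => //.
  exact: measurable_cutoff_diff.
- move=> n x; rewrite normrM normr_id (ger0_norm (psi0 x)) ler_piMl//.
  exact: cutoff_indic_dist.
- move=> x; have [Ax|Ax] := pselect (A x); last first.
    rewrite (_ : (fun n => _) = cst 0); first exact: cvg_cst.
    by apply/funext => n; rewrite /chi dlNA// mulr0 indicE memNset// min_r// subrr normr0 mul0r.
  have [N HN] : exists N, (dl x)^-1 <= N%:R.
    exists (Num.bound (dl x)^-1); apply: ltW; apply: archi_boundP.
    by rewrite invr_ge0.
  apply: (@eventually0_cvg _ N) => n Nn; rewrite /chi indicE mem_set// min_l ?subrr ?normr0 ?mul0r//.
  rewrite -ler_pdivrMr ?dlA// div1r; apply: le_trans HN _.
  by rewrite ler_nat.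
by exists (chi n).
Qed.

Lemma cutoff_approximable_setC (A : set X) : cutoff_approximable A -> cutoff_approximable (~` A).
Proof.
move=> [mA HA]; split; first exact: measurableC.
move=> e e0; have [chi [[C LC] c01] Hc] := HA _ e0; exists (fun x => 1 - chi x).
  split; last by move=> x; have := c01 x; lra.
  exists C => x y; apply: le_trans (LC x y).
  by rewrite (_ : _ - _ = - (chi x - chi y)) ?normrN//; ring.
rewrite (_ : (fun x => _) = (fun x => `|chi x - \1_A x| * psi x))//.
apply/funext => x; rewrite !indicE in_setC; congr (_ * _).
by rewrite distrC; case: (x \in A) => /=; congr `|_|; ring.
Qed.

Lemma cutoff_approximable_setU (A B : set X) :
  cutoff_approximable A -> cutoff_approximable B -> cutoff_approximable (A `|` B).
Proof.
move=> [mA HA] [mB HB]; split; first exact: measurableU.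
move=> e e0; have e2 : 0 < e / 2 by lra.
have [a ca Ha] := HA _ e2; have [b cb Hb] := HB _ e2.
have maxd (p q r s : R) : `|Num.max p q - Num.max r s| <= `|p - r| + `|q - s|.
  have := ler_norm (p - r); have := ler_norm (- (p - r)); rewrite normrN.
  have := ler_norm (q - s); have := ler_norm (- (q - s)); rewrite normrN.
  by rewrite ler_norml; have [?|?] := leP p q; have [?|?] := leP r s; lra.
have cab : lipschitz_cutoff (fun x => Num.max (a x) (b x)).
  have [[C LC] a01] := ca; have [[D LD] b01] := cb; split.
    by exists (C + D) => x y; apply: le_trans (maxd _ _ _ _) _; rewrite mulrDl lerD.
  move=> x; have := a01 x; have := b01 x.
  by have [?|?] := leP (a x) (b x).
exists (fun x => Num.max (a x) (b x)) => //.
have wa : m.-integrable setT (EFin \o (fun x => `|a x - \1_A x| * psi x)).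
  by apply: weighted_integrable => [|x]; [exact: measurable_cutoff_diff|exact: cutoff_indic_dist].
have wb : m.-integrable setT (EFin \o (fun x => `|b x - \1_B x| * psi x)).
  by apply: weighted_integrable => [|x]; [exact: measurable_cutoff_diff|exact: cutoff_indic_dist].
apply: le_trans (_ : \int[m]_x (`|a x - \1_A x| * psi x + `|b x - \1_B x| * psi x) <= _).
  apply: le_Rintegral => //.
  - apply: (@weighted_integrable (fun x => Num.max (a x) (b x) - \1_(A `|` B) x)) => [|x].
      exact: measurable_cutoff_diff cab (measurableU _ _ mA mB).
    exact: cutoff_indic_dist _ _ cab.
  - exact: (integrableD measurableT wa wb).
  move=> x _; rewrite -mulrDl ler_wpM2r//.
  apply: le_trans (maxd _ _ _ _); rewrite le_eqVlt; apply/orP; left; apply/eqP.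
  congr `|_ - _|; rewrite !indicE in_setU.
  by case: (x \in A); case: (x \in B) => /=; case: leP => //; rewrite ?ltr01 ?ler01 ?ltr10 ?ler10.
by rewrite RintegralD//; lra.
Qed.

Lemma cutoff_approximable_bigcup (A : nat -> set X) :
  (forall n, cutoff_approximable (A n)) -> cutoff_approximable (\bigcup_n A n).
Proof.
move=> HA; have mU : measurable (\bigcup_n A n).
  by apply: bigcup_measurable => n _; have [] := HA n.
split => // e e0; have e2 : 0 < e / 2 by lra.
pose B n := \big[setU/set0]_(i < n) A i.
have BA n x : B n x -> (\bigcup_n A n) x.
  by rewrite /B -bigcup_mkord => -[i _ Ax]; exists i.
have HB n : cutoff_approximable (B n).
  elim: n => [|n IH]; last by rewrite /B big_ord_recr; exact: cutoff_approximable_setU.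
  rewrite /B big_ord0 -setCT; apply: cutoff_approximable_setC.
  by apply: cutoff_approximable_open; exact: openT.
have mB n : measurable (B n) by have [] := HB n.
have d1 n x : `|\1_(B n) x - \1_(\bigcup_n A n) x : R| <= 1.
  by rewrite !indicE; case: (_ \in _); case: (_ \in _); rewrite /= ?subrr ?normr0 ?subr0 ?sub0r ?normrN ?normr1.
have md n : measurable_fun setT (fun x => \1_(B n) x - \1_(\bigcup_n A n) x : R).
  by apply: measurable_funB; exact: measurable_indic.
have [|||n Hn] := @Rintegral_dominated_small
    (fun n x => `|\1_(B n) x - \1_(\bigcup_n A n) x| * psi x) psi _ e2 ipsi.
- by move=> n; apply: measurable_funM => //; apply: measurableT_comp.
- by move=> n x; rewrite normrM normr_id (ger0_norm (psi0 x)) ler_piMl.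
- move=> x; have [[N _ ANx]|Ax] := pselect ((\bigcup_n A n) x); last first.
    rewrite (_ : (fun n => _) = cst 0); first exact: cvg_cst.
    apply/funext => n; rewrite !indicE !memNset ?subrr ?normr0 ?mul0r//.
    by move=> /BA.
  apply: (@eventually0_cvg _ N.+1) => n Nn; rewrite !indicE !mem_set ?subrr ?normr0 ?mul0r//.
    by exists N.
  by rewrite /B -bigcup_mkord; exists N.
have [_ /(_ _ e2)[chi cchi Hc]] := HB n.
exists chi => //.
have wa : m.-integrable setT (EFin \o (fun x => `|chi x - \1_(B n) x| * psi x)).
  by apply: weighted_integrable => [|x]; [exact: measurable_cutoff_diff|exact: cutoff_indic_dist].
have wb : m.-integrable setT (EFin \o (fun x => `|\1_(B n) x - \1_(\bigcup_n A n) x| * psi x)).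
  exact: weighted_integrable.
apply: le_trans (_ : \int[m]_x (`|chi x - \1_(B n) x| * psi x +
    `|\1_(B n) x - \1_(\bigcup_n A n) x| * psi x) <= _).
  apply: le_Rintegral => //.
  - apply: (@weighted_integrable (fun x => chi x - \1_(\bigcup_n A n) x)) => [|x].
      exact: measurable_cutoff_diff.
    exact: cutoff_indic_dist _ _ cchi.
  - exact: (integrableD measurableT wa wb).
  by move=> x _; rewrite -mulrDl ler_wpM2r// ler_distD.
by rewrite RintegralD//; lra.
Qed.

Lemma measurable_cutoff_approximable (B : set X) : measurable B -> cutoff_approximable B.
Proof.
rewrite measurable_borel; move: B; apply: smallest_sub; last exact: cutoff_approximable_open.
split; last exact: cutoff_approximable_bigcup.
- by apply: cutoff_approximable_open; exact: open0.
- by move=> A HA; rewrite setTD; exact: cutoff_approximable_setC.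
Qed.

End density.

(** * Bounds on the minimal relaxed gradient *)

Section minimal_gradient.
Context {R : realType} {d : measure_display} {X : borelMetricType R d}.
Variable m : probability X R.
Hypothesis compactX : compact [set: X].
Implicit Types (f g h u v w : X -> R) (x y : X) (e : R).
Local Notation L2 := (Lfun m 2%:E).
Local Notation sqn := (sqn m).

Lemma L2_min h c : h \in L2 -> (fun x => Num.min (h x) c) \in L2.
Proof.
move=> h2; have mh := L2_measurable h2.
apply: (@L2_le _ _ _ _ _ (fun x => `|h x| + `|c|)).
- by apply: measurable_minr.
- move=> x; rewrite [leRHS]ger0_norm ?addr_ge0//.
  by have [|] := leP (h x) c; rewrite ?lerDl ?lerDr.
- apply: L2D; last exact: Lfun_cst.
  by apply: (L2_le _ _ h2) => [|x]; [exact: measurableT_comp|rewrite normr_id].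
Qed.

(** On [B = {h > c}] one may trade [h] for [c]: interpolate with Lipschitz cutoffs
    approximating the indicator of [B] in the measure of density [(h - c)^2]. *)
Lemma strong_gradient_min f h c : f \in L2 -> h \in L2 ->
  strong_gradient m f h -> strong_gradient m f (cst c) ->
  strong_gradient m f (fun x => Num.min (h x) c).
Proof.
move=> f2 h2 fh fc; have c2 : cst c \in L2 by exact: Lfun_cst.
have mh := L2_measurable h2.
have min2 := L2_min c h2.
apply: strong_gradient_closed => // e e0.
pose B := [set x | c < h x].
have mB : measurable B.
  have := mh measurableT _ (measurable_itv `]c, +oo[).
  rewrite setTI (_ : h @^-1` _ = B)//.
  by apply/seteqP; split => x /=; rewrite in_itv/= andbT.
have hc2 : (fun x => h x - c) \in L2 by exact: (L2B h2 c2).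
have psi0 x : 0 <= (h x - c) ^+ 2 by exact: sqr_ge0.
have ipsi := L2_sqr_integrable hc2.
have [_ /(_ _ e0)[chi cut chiB]] := measurable_cutoff_approximable psi0 ipsi mB.
have [Lchi chi01] := cut; have [L L0 chiL] := is_lipschitzW Lchi.
have mchi := measurable_lipschitz Lchi.
have p2 : (fun x => (chi x - \1_B x) * (c - h x)) \in L2.
  apply: (L2_le _ _ hc2) => [|x].
    apply: measurable_funM; first exact: measurable_cutoff_diff.
    exact: measurable_funB.
  by rewrite normrM distrC [X in _ * X]distrC ler_piMl// distrC cutoff_indic_dist.
exists (fun x => (1 - chi x) * h x + chi x * c).
have E x : (1 - chi x) * h x + chi x * c - Num.min (h x) c =
    (chi x - \1_B x) * (c - h x).
  rewrite indicE; have [hc|hc] := leP (h x) c.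
    rewrite memNset; last by rewrite /B /= ltNge hc.
    by rewrite /=; ring.
  by rewrite mem_set//=; ring.
split.
- rewrite (_ : (fun x => _) = (fun x => Num.min (h x) c + (chi x - \1_B x) * (c - h x))).
    exact: L2D.
  by apply/funext => x; rewrite -E [RHS]addrC subrK.
- exact: (strong_gradient_interpolation compactX L0 chiL chi01 f2 h2 c2 fh fc).
- rewrite (funext E); apply: le_trans chiB; apply: le_Rintegral => //.
  + exact: L2_sqr_integrable.
  + apply: (le_integrable measurableT _ _ ipsi).
      apply/measurable_EFinP; apply: measurable_funM.
        by apply: measurableT_comp => //; exact: measurable_cutoff_diff.
      by apply: measurable_funX; exact: L2_measurable hc2.
    move=> x _ /=; rewrite lee_fin normrM normr_id ler_piMl//.
    exact: cutoff_indic_dist.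
  + move=> x _; rewrite exprMn -[(c - h x) ^+ 2]sqrrN opprB ler_wpM2r//.
    rewrite -[leLHS]ger0_norm ?sqr_ge0// normrX expr2 ler_piMl//.
    exact: cutoff_indic_dist.
Qed.

(** Otherwise [min h c] would be a relaxed gradient of smaller norm. *)
Lemma minimal_gradient_le f h c : 0 <= c -> f \in L2 -> relaxed_gradient m f h ->
  (forall h', relaxed_gradient m f h' ->
    ('N[m]_2%:E[EFin \o h] <= 'N[m]_2%:E[EFin \o h'])%E) ->
  strong_gradient m f (cst c) -> {ae m, forall x, 0 <= h x <= c}.
Proof.
move=> c0 f2 rh hmin fc; have [_ h2 _] := rh; have mh := L2_measurable h2.
have fh := relaxed_gradient_strong compactX rh.
have h0 := strong_gradient_ge0 h2 fh.
pose hp x := Num.max (h x) 0; pose gp x := Num.min (hp x) c.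
have mhp : measurable_fun setT hp by apply: measurable_maxr.
have mgp : measurable_fun setT gp by apply: measurable_minr.
have hp0 x : 0 <= hp x by rewrite le_max lexx orbT.
have gp0 x : 0 <= gp x by rewrite le_min hp0.
have gphp x : gp x <= hp x by rewrite ge_min lexx.
have hp2 : hp \in L2.
  apply: (L2_le mhp _ h2) => x; rewrite ger0_norm// /hp.
  by rewrite ge_max ler_norm normr_ge0.
have gp2 : gp \in L2 by apply: (L2_le mgp _ hp2) => x; rewrite !ger0_norm.
have min2 := L2_min c h2.
have hmin' : sqn h <= sqn (fun x => Num.min (h x) c).
  have := hmin _ (strong_gradient_relaxed compactX f2 min2 (strong_gradient_min f2 h2 fh fc)).
  by rewrite !Lnorm2_sqn// lee_fin ler_psqrt ?nnegrE ?sqn_ge0.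
have hp_le_gp : sqn hp <= sqn gp.
  apply: le_trans (_ : sqn h <= _).
    by apply: le_sqn => // x; rewrite ger0_norm// /hp ge_max ler_norm normr_ge0.
  apply: le_trans hmin' _; apply: le_sqn_ae => //.
  by apply: filterS h0 => x hx; rewrite /gp /hp max_l.
have diff2 : (fun x => hp x - gp x) \in L2 by exact: L2B.
have diff0 : sqn (fun x => hp x - gp x) = 0.
  apply/eqP; rewrite eq_le sqn_ge0 andbT.
  rewrite -(subr_le0 (sqn gp)) in hp_le_gp; apply: le_trans hp_le_gp.
  have ihp := L2_sqr_integrable hp2; have igp := L2_sqr_integrable gp2.
  rewrite -RintegralB//; apply: le_Rintegral => //.
  - exact: L2_sqr_integrable.
  - exact: (integrableB measurableT ihp igp).
  - by move=> x _; have := gphp x; have := gp0 x; nra.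
apply: filterS2 h0 (sqn_eq0_ae diff2 diff0) => x hx; rewrite hx /=.
by rewrite /gp /hp max_l// => /eqP; rewrite subr_eq0 => /eqP ->; rewrite ge_min lexx orbT.
Qed.

Lemma ae_bounded_Lfuny f M : measurable_fun setT f -> {ae m, forall x, `|f x| <= M} ->
  f \in Lfun m +oo%E /\ ('N[m]_+oo[EFin \o f] <= M%:E)%E.
Proof.
move=> mf fM; have N : ('N[m]_+oo[EFin \o f] <= M%:E)%E.
  rewrite unlock /= probability_setT lte01; apply/ess_supP.
  by apply: filterS fM => x; rewrite lee_fin.
split => //; rewrite inE; apply/andP; split; rewrite inE//=.
by rewrite /finite_norm; apply: le_lt_trans N (ltry _).
Qed.

(** If no relaxed gradient has minimal norm, the default value [0] obeys the same
    bounds. *)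
Lemma min_relaxed_gradient_le f c : 0 <= c -> f \in L2 ->
  strong_gradient m f (cst c) ->
  min_relaxed_gradient m f \in L2 /\
  {ae m, forall x, 0 <= min_relaxed_gradient m f x <= c}.
Proof.
move=> c0 f2 fc; rewrite /min_relaxed_gradient; case: xgetP => [h -> [rh hmin]|_].
  by split; [case: rh|exact: minimal_gradient_le hmin fc].
by split; [exact: Lfun_cst|apply: nearW => x; rewrite lexx].
Qed.

(** The open set where they differ is null, hence empty. *)
Lemma ae_eq_continuous f g : full_support m -> continuous f -> continuous g ->
  {ae m, forall x, f x = g x} -> f =1 g.
Proof.
move=> supp cf cg [N [mN N0 HN]] x; apply: contrapT => fgx.
have oU : open [set y | f y != g y].
  have -> : [set y | f y != g y] = (fun y => f y - g y) @^-1` [set t | t != 0].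
    by apply/seteqP; split => y /=; rewrite subr_eq0.
  apply: open_comp; last exact: open_neq.
  by move=> y _; apply: cvgB; [exact: cf|exact: cg].
have : (0 < m [set y | f y != g y])%E by apply: supp => //; exists x; apply/eqP.
have : (m [set y | f y != g y] <= m N)%E.
  apply: le_measure; rewrite ?inE//; first exact: open_measurable_borel.
  by move=> y fgy; apply: HN => /=; exact/eqP.
by rewrite N0 leNgt => /negbTE ->.
Qed.

(** The minimal relaxed gradient of [f] is at most [c], so [f] has a Lipschitz
    representative with constant [c], which is [f] itself by continuity. *)
Lemma strong_gradient_lipschitz f c : full_support m -> sobolev_to_lipschitz m ->
  0 <= c -> continuous f -> strong_gradient m f (cst c) -> lipschitz_with c f.
Proof.
move=> supp stl c0 cf fc; have mf := continuous_measurable_borel cf.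
have [M _ fM] := compact_continuous_bounded compactX cf.
have f2 : f \in L2 by exact: L2_bounded mf fM.
have c2 : cst c \in L2 by exact: Lfun_cst.
have [Df2 Dfc] := min_relaxed_gradient_le c0 f2 fc.
have rf : exists h, relaxed_gradient m f h.
  by exists (cst c); exact: strong_gradient_relaxed.
have [fy _] := ae_bounded_Lfuny mf (nearW _ fM).
have Dfc' : {ae m, forall x, `|min_relaxed_gradient m f x| <= c}.
  by apply: filterS Dfc => x /andP[D0 D1]; rewrite ger0_norm.
have [Dfy Dfyc] := ae_bounded_Lfuny (L2_measurable Df2) Dfc'.
have [||g [Lg gf lg]] := stl f.
- split => //; rewrite /finite_sobolev_norm poweR_lty// lte_add_pinfty//;
    by rewrite poweR_lty// Lnorm2_sqn// ltry.
- by split.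
have -> : f = g.
  by apply/funext => x; apply/esym; apply: ae_eq_continuous => //; exact: lipschitz_continuous.
move=> x y; apply/ler_addgt0Pr => e e0.
have r0 : 0 < e / (mdist x y + 1) by rewrite divr_gt0// ltr_wpDl// mdist_ge0.
have : (lip_const g < (c + e / (mdist x y + 1))%:E)%E.
  by rewrite lg; apply: le_lt_trans Dfyc _; rewrite lte_fin ltrDl.
move=> /ereal_inf_lt[_ [C [C0 gC] <-]]; rewrite lte_fin => Cc.
apply: le_trans (gC x y) _; apply: le_trans (ler_wpM2r (mdist_ge0 _ _) (ltW Cc)) _.
rewrite mulrDl lerD2l mulrAC ler_pdivrMr ?ltr_wpDl ?mdist_ge0//.
by rewrite ler_pM2l// lerDl.
Qed.

End minimal_gradient.

(** * Morrey estimate *)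

Section morrey.
Context {R : realType} {d : measure_display} {X : borelMetricType R d}.
Variable m : probability X R.
Hypothesis compactX : compact [set: X].
Hypothesis supp_m : full_support m.
Implicit Types (f g h u v w : X -> R) (x y : X) (e : R) (A B : set X).

Let vol A : R := fine (m A).

Let vol_E A : measurable A -> m A = (vol A)%:E.
Proof. by move=> mA; rewrite /vol fineK// fin_num_measure. Qed.

Let vol_le A B : measurable A -> measurable B -> A `<=` B -> vol A <= vol B.
Proof.
move=> mA mB AB; rewrite -lee_fin -!vol_E//.
by apply: le_measure; rewrite ?inE.
Qed.

Lemma ball_measure_gt0 x r : 0 < r -> 0 < fine (m (ball x r)).
Proof.
move=> r0; rewrite -lte_fin -[(fine _)%:E]vol_E; last exact: measurable_ballX.
apply: supp_m; first exact: open_ballX.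
by exists x; rewrite ballEmdist /= mdistxx.
Qed.

Let vol_ball_gt0 x r : 0 < r -> 0 < vol (ball x r).
Proof. exact: ball_measure_gt0. Qed.

Lemma bounded_integrable f M A : measurable_fun setT f -> (forall x, `|f x| <= M) ->
  measurable A -> m.-integrable A (EFin \o f).
Proof.
move=> mf fM mA; apply: (@integrableS _ _ _ m setT) => //.
apply: measurable_bounded_integrable => //; last first.
  by exists M; split; [exact: num_real|move=> N MN x _ /=]; apply: le_trans (fM x) (ltW MN).
by rewrite (le_lt_trans (probability_le1 _ _)) ?ltry.
Qed.

Lemma Rintegral_subset f A B : measurable A -> measurable B -> A `<=` B ->
  m.-integrable B (EFin \o f) -> (forall x, 0 <= f x) ->
  \int[m]_(x in A) f x <= \int[m]_(x in B) f x.
Proof.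
move=> mA mB AB fi f0; apply: fine_le.
- by apply: integrable_fin_num => //; exact: integrableS fi.
- exact: integrable_fin_num.
- apply: ge0_subset_integral => //; first exact: measurable_int fi.
  by move=> x _; rewrite lee_fin.
Qed.

(** Compares the averages over nested balls of comparable measure. *)
Lemma mean_dist_le_mean f A B a k : is_lipschitz f -> measurable A -> measurable B ->
  A `<=` B -> 0 < vol A -> vol B <= k * vol A ->
  `|mean m A f - a| <= k * mean m B (fun y => `|f y - a|).
Proof.
move=> Lf mA mB AB A0 Bk; have mf := measurable_lipschitz Lf.
have [M M0 fM] := compact_lipschitz_bounded compactX Lf.
have B0 : 0 < vol B by apply: lt_le_trans A0 (vol_le _ _ _).
have fi C : measurable C -> m.-integrable C (EFin \o f) by exact: bounded_integrable fM.
have ai C : measurable C -> m.-integrable C (EFin \o (fun=> a)).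
  by move=> mC; apply: (@bounded_integrable _ `|a|).
have fai C : measurable C -> m.-integrable C (EFin \o (fun x => f x - a)).
  by move=> mC; exact: (integrableB mC (fi _ mC) (ai _ mC)).
have nfai C : measurable C -> m.-integrable C (EFin \o (fun x => `|f x - a|)).
  apply: (@bounded_integrable _ (M + `|a|)).
    by apply: measurableT_comp => //; exact: measurable_funB.
  by move=> y; rewrite normr_id (le_trans (ler_normB _ _))// lerD.
have -> : mean m A f - a = (vol A)^-1 * \int[m]_(x in A) (f x - a).
  rewrite RintegralB//; [|exact: fi|exact: ai].
  rewrite Rintegral_cst// mulrBr -/(vol A) [a * _]mulrC mulrA mulVf ?gt_eqF//.
  by rewrite mul1r.
rewrite normrM gtr0_norm ?invr_gt0//.
rewrite /mean -/(vol B) mulrA.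
have i0 : 0 <= \int[m]_(x in B) `|f x - a| by apply: Rintegral_ge0.
apply: (@le_trans _ _ ((vol A)^-1 * \int[m]_(x in B) `|f x - a|)).
  rewrite ler_pM2l ?invr_gt0//.
  apply: le_trans (le_normr_Rintegral mA (fai _ mA)) _.
  by apply: Rintegral_subset => //; exact: nfai.
rewrite ler_wpM2r//.
by rewrite ler_pdivlMr// mulrC ler_pdivrMr.
Qed.

Lemma mean_le A f g M N : measurable A -> measurable_fun setT f -> measurable_fun setT g ->
  (forall x, `|f x| <= M) -> (forall x, `|g x| <= N) -> (forall x, f x <= g x) ->
  mean m A f <= mean m A g.
Proof.
move=> mA mf mg fM gN fg; rewrite ler_wpM2l ?invr_ge0 ?fine_ge0//.
by apply: le_Rintegral => //; [exact: bounded_integrable fM _|exact: bounded_integrable gN _].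
Qed.

Lemma mean_ball_near f C x r : 0 <= C -> lipschitz_with C f -> 0 < r ->
  `|mean m (ball x r) f - f x| <= C * r.
Proof.
move=> C0 fC r0; have Lf : is_lipschitz f by exists C.
have mB := measurable_ballX x r; have B0 := vol_ball_gt0 x r0.
have := @mean_dist_le_mean f _ _ (f x) 1 Lf mB mB (@subset_refl _ _) B0.
rewrite !mul1r => /(_ (lexx _))/le_trans; apply.
rewrite /mean -/(vol _) mulrC ler_pdivrMr//.
rewrite -Rintegral_cst//; have mf := measurable_lipschitz Lf.
have [M M0 fM] := compact_lipschitz_bounded compactX Lf.
apply: le_Rintegral => //.
- apply: (@bounded_integrable _ (M + M)) => //.
    by apply: measurableT_comp => //; exact: measurable_funB.
  by move=> y; rewrite normr_id (le_trans (ler_normB _ _))// lerD.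
- exact: (@bounded_integrable _ `|C * r|).
- move=> y; rewrite ballEmdist /= => xy; rewrite distrC; apply: le_trans (fC x y) _.
  by rewrite ler_wpM2l// ltW.
Qed.

(** The bound on the averages of [t ^ q] by those of [t ^ p] that would follow from
    Jensen's inequality, up to a factor [2]. *)
Lemma powR_split (a t p q : R) : 0 <= a -> 0 < t -> 0 < q -> q <= p ->
  a `^ q <= t `^ q + t `^ (q - p) * a `^ p.
Proof.
move=> a0 t0 q0 qp; have [at_|ta] := leP a t.
  apply: le_trans (_ : t `^ q <= _); first by rewrite ge0_ler_powR// ?nnegrE ltW.
  by rewrite lerDl mulr_ge0 ?powR_ge0.
have a0' : 0 < a by apply: lt_trans ta.
apply: le_trans (_ : t `^ (q - p) * a `^ p <= _); last by rewrite lerDr powR_ge0.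
have -> : q - p = - (p - q) by ring.
rewrite powRN mulrC ler_pdivlMr ?powR_gt0//.
have -> : a `^ p = a `^ q * a `^ (p - q).
  by rewrite -powRD ?subrKC//; apply/implyP => _; rewrite gt_eqF.
rewrite ler_pM2l ?powR_gt0// ge0_ler_powR// ?nnegrE ?subr_ge0//; exact: ltW.
Qed.

Lemma diameter_bound : exists N, forall x, ball x (2 ^+ N) = [set: X].
Proof.
have [[x0 _]|X0] := pselect ([set: X] !=set0); last first.
  by exists 0%N => x; exfalso; apply: X0; exists x.
have Ld : is_lipschitz (fun y => mdist x0 y).
  exists 1 => y z; rewrite mul1r ler_norml.
  have := metric_triangle x0 y z; have := metric_triangle x0 z y.
  by rewrite (metric_sym z y); lra.
have [M M0 dM] := compact_lipschitz_bounded compactX Ld.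
have [N HN] : exists N, M + M < 2 ^+ N.
  exists (Num.bound (M + M)); apply: lt_le_trans (archi_boundP _) _; first exact: addr_ge0.
  by rewrite -natrX ler_nat ltnW// ltn_expl.
exists N => x; apply/seteqP; split => // y _; rewrite ballEmdist /=.
apply: le_lt_trans (metric_triangle x x0 y) _; apply: le_lt_trans HN.
by rewrite metric_sym lerD//; apply: le_trans (ler_norm _) (dM _).
Qed.

(** The ball of radius [2 ^+ N] is the whole space, of measure [1], and each halving
    of the radius divides the measure by at most [C]. *)
Lemma doubling_iter (C : R) N : 0 < C ->
  (forall x r, 0 < r -> (m (ball x (2 * r)) <= C%:E * m (ball x r))%E) ->
  (forall x, ball x (2 ^+ N) = [set: X]) ->
  forall j x, 1 <= C ^+ (j + N) * vol (ball x (2^-1 ^+ j)).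
Proof.
move=> C0 dbl HN j x.
have H k : 1 <= C ^+ k * vol (ball x (2 ^+ N * 2^-1 ^+ k)).
  elim: k => [|k IH]; first by rewrite expr0 mulr1 HN mul1r /vol probability_setT.
  apply: le_trans IH _; rewrite exprSr -mulrA ler_pM2l ?exprn_gt0//.
  have r0 : (0 : R) < 2 ^+ N * 2^-1 ^+ k.+1 by rewrite mulr_gt0 ?exprn_gt0// invr_gt0.
  have := dbl x _ r0; rewrite !vol_E; [|exact: measurable_ballX..].
  rewrite -EFinM lee_fin; congr (vol (ball x _) <= _).
  by rewrite exprS; field.
have := H (j + N)%N; congr (_ <= _ * vol (ball x _)).
by rewrite exprD mulrCA -exprMn divff// expr1n mulr1.
Qed.

(** Beyond a threshold exponent [p1] a bound on the [p]-energy controls the modulus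
    of continuity uniformly in [p]: doubling bounds the volume of small balls below,
    the Poincare inequality turns this into a geometric decay [(3/4)^j] of the
    oscillation at scale [2^-j], and one telescopes over scales. *)
Lemma morrey_modulus (c : R) : 0 < c -> doubling m -> poincare m ->
  exists p1 K : R, forall (p : R) f, p1 <= p -> is_lipschitz f ->
    \int[m]_x (lip f x `^ p) <= c `^ p ->
    forall k x y, mdist x y < 2^-1 ^+ k.+1 -> `|f x - f y| <= K * (3 / 4) ^+ k.
Proof.
move=> c0 [CD0 CD00 dbl0] [p0 [CP [s [p01 CP0 s1 poin]]]].
have [N HN] := diameter_bound.
pose CD := Num.max 1 CD0; have CD1 : 1 <= CD by rewrite le_max lexx.
have CDgt0 : 0 < CD by apply: lt_le_trans CD1.
have dblE x r : 0 < r -> (m (ball x (2 * r)) <= CD%:E * m (ball x r))%E.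
  move=> r0; apply: le_trans (dbl0 x r r0) _.
  by rewrite lee_wpmul2r// lee_fin le_max lexx orbT.
have dbl x r : 0 < r -> vol (ball x (2 * r)) <= CD * vol (ball x r).
  move=> r0; have := dblE x r r0; rewrite !vol_E; [|exact: measurable_ballX..].
  by rewrite -EFinM lee_fin.
have volj := doubling_iter CDgt0 dblE HN.
pose th : R := 3 / 2; have th1 : 1 < th by rewrite /th; lra.
have th0 : 0 < th by lra.
have th0' := ltW th0; have c0' := ltW c0; have CP0' := ltW CP0; have CD0' := ltW CDgt0.
pose p1 := Num.max p0 (ln CD / ln th).
pose K0 := CP * 2 * c * th ^+ N.
have K00 : 0 <= K0 by rewrite !mulr_ge0 ?exprn_ge0.
exists p1, ((8 * CD + CD ^+ 2) * K0) => p f p1p Lf fc.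
have p0gt0 : 0 < p0 by apply: lt_le_trans p01.
have p0p : p0 <= p by apply: le_trans p1p; rewrite le_max lexx.
have pgt0 : 0 < p by apply: lt_le_trans p0p.
have CDth : CD <= th `^ p.
  rewrite -[CD]lnK ?posrE// /powR gt_eqF// ler_expR -ler_pdivrMr ?ln_gt0//.
  by apply: le_trans p1p; rewrite le_max lexx orbT.
have [L L0 fL] := is_lipschitzW Lf.
have [M M0 fM] := compact_lipschitz_bounded compactX Lf.
have mf := measurable_lipschitz Lf; have ml := measurable_lip Lf.
have l0 x := lip_ge0 x Lf.
have lL x : lip f x <= L by exact: lip_le.
have mlq q : measurable_fun setT (fun x => lip f x `^ q).
  by apply: (measurableT_comp (measurable_powR _)).
have lqb q x : 0 <= q -> `|lip f x `^ q| <= L `^ q.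
  by move=> q0; rewrite ger0_norm ?powR_ge0// ge0_ler_powR// ?nnegrE.
have r0 j : (0 : R) < 2^-1 ^+ j by rewrite exprn_gt0// invr_gt0.
pose osc x j := mean m (ball x (2^-1 ^+ j)) (fun y => `|f y - mean m (ball x (2^-1 ^+ j)) f|).
have osc_le x j : osc x j <= K0 * (3 / 4) ^+ j.
  apply: le_trans (poin x (2^-1 ^+ j) f (r0 j) Lf) _.
  (* [t] is the level for which [t ^ p] bounds the average of [lip f ^ p] over [B],
     because [CD <= th ^ p]. *)
  pose t := c * th ^+ (j + N).
  have t0 : 0 < t by rewrite mulr_gt0// exprn_gt0.
  have t0' := ltW t0.
  set B := ball x (s * 2^-1 ^+ j).
  have mB : measurable B by exact: measurable_ballX.
  have B0 : 0 < vol B by apply: vol_ball_gt0; rewrite mulr_gt0//; apply: lt_le_trans s1.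
  have volB : 1 <= CD ^+ (j + N) * vol B.
    apply: le_trans (volj j x) _; rewrite ler_pM2l ?exprn_gt0//.
    apply: vol_le => //; first exact: measurable_ballX.
    by apply: le_ball; rewrite ler_peMl// exprn_ge0// invr_ge0.
  have energy : mean m B (fun y => lip f y `^ p) <= t `^ p.
    rewrite /mean -/(vol B) mulrC ler_pdivrMr//.
    apply: le_trans (_ : c `^ p <= _).
      apply: le_trans fc; apply: Rintegral_subset => // [|z]; last exact: powR_ge0.
      by apply: (@bounded_integrable _ (L `^ p)) => // z; apply: lqb; exact: ltW.
    rewrite /t powRM ?exprn_ge0// -mulrA ler_peMr ?powR_ge0//.
    apply: le_trans volB _; rewrite ler_pM2r//.
    rewrite -powR_mulrn// -powRrM mulrC powRrM powR_mulrn ?powR_ge0//.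
    by rewrite lerXn2r// nnegrE powR_ge0.
  have energy0 : mean m B (fun y => lip f y `^ p0) <= 2 * t `^ p0.
    apply: le_trans (_ : mean m B (fun y => t `^ p0 + t `^ (p0 - p) * lip f y `^ p) <= _).
      apply: (@mean_le _ _ _ (L `^ p0) (t `^ p0 + t `^ (p0 - p) * L `^ p)) => //.
      - by apply: measurable_funD => //; apply: measurable_funM.
      - by move=> z; apply: lqb; exact: ltW.
      - move=> z; rewrite ger0_norm ?addr_ge0 ?mulr_ge0 ?powR_ge0//.
        rewrite lerD2l ler_wpM2l ?powR_ge0//.
        by apply: le_trans (ler_norm _) (lqb _ _ _); exact: ltW.
      - by move=> z; apply: powR_split.
    rewrite /mean -/(vol B).
    have li : m.-integrable B (EFin \o (fun x => lip f x `^ p)).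
      by apply: (@bounded_integrable _ (L `^ p)) => // z; apply: lqb; exact: ltW.
    have li' : m.-integrable B (EFin \o (fun x => t `^ (p0 - p) * lip f x `^ p)).
      exact: (integrableZl mB (t `^ (p0 - p)) li).
    rewrite RintegralD//; last by apply: (@bounded_integrable _ `|t `^ p0|).
    rewrite Rintegral_cst// RintegralZl// mulrDr -/(vol B) mulrCA mulVf ?gt_eqF// mulr1.
    rewrite mulrCA [leRHS]mulrDl mul1r lerD2l.
    apply: le_trans (ler_wpM2l (powR_ge0 _ _) energy) _.
    by rewrite -powRD ?subrK//; rewrite (gt_eqF t0) implybT.
  have pw : mean m B (fun y => lip f y `^ p0) `^ p0^-1 <= 2 * t.
    apply: le_trans (_ : (2 * t `^ p0) `^ p0^-1 <= _).
      rewrite ge0_ler_powR ?nnegrE ?invr_ge0 ?mulr_ge0 ?powR_ge0 ?(ltW p0gt0)//.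
      by apply: Rintegral_ge0 => z _; exact: powR_ge0.
    rewrite powRM ?powR_ge0// -powRrM divff ?gt_eqF// powRr1//.
    rewrite ler_pM2r//; apply: ler1_powR; first lra.
    by rewrite invf_le1.
  apply: le_trans (ler_wpM2l _ pw) _; first by rewrite mulr_ge0// exprn_ge0// invr_ge0.
  rewrite /K0 /t exprD (_ : (3 / 4 : R) = 2^-1 * th); last by rewrite /th; field.
  rewrite [(2^-1 * th) ^+ j]exprMn; move: (2^-1 ^+ j) (th ^+ j) (th ^+ N) => u v w.
  by rewrite le_eqVlt; apply/orP; left; apply/eqP; ring.
pose F x j := mean m (ball x (2^-1 ^+ j)) f.
have mb x r := measurable_ballX x r.
have step x j : `|F x j.+1 - F x j| <= CD * (K0 * (3 / 4) ^+ j).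
  apply: le_trans (ler_wpM2l CD0' (osc_le x j)).
  apply: mean_dist_le_mean => //; first by apply: le_ball; rewrite exprS ler_piMl ?exprn_ge0 ?invr_ge0//; lra.
  exact: vol_ball_gt0.
  have := dbl x _ (r0 j.+1); congr (vol (ball x _) <= _).
  by rewrite exprS mulrA divff// mul1r.
(* Since [4 * (1 - 3 / 4) = 1], the bound in [step] is the decrement of
   [4 * CD * K0 * (3 / 4) ^+ j]. *)
have tele x i n : `|F x (i + n)%N - F x i| <= 4 * CD * K0 * (3 / 4) ^+ i - 4 * CD * K0 * (3 / 4) ^+ (i + n)%N.
  elim: n => [|n IH]; first by rewrite addn0 !subrr normr0.
  rewrite addnS; have := le_trans (ler_normD _ _) (lerD (step x (i + n)%N) IH).
  rewrite (_ : _ + (_ - F x i) = F x (i + n).+1 - F x i); last by ring.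
  move/le_trans; apply; rewrite exprS.
  by move: ((3 / 4) ^+ (i + n)) ((3 / 4) ^+ i) => a b; lra.
have lim x i : `|f x - F x i| <= 4 * CD * K0 * (3 / 4) ^+ i.
  apply/ler_addgt0Pr => e e0.
  have [j [ij Hj]] : exists j, (i <= j)%N /\ L * 2^-1 ^+ j <= e.
    have : L * 2^-1 ^+ j @[j --> \oo] --> L * 0.
      apply: cvgM; first exact: cvg_cst.
      by apply: cvg_expr; rewrite ger0_norm ?invf_lt1//; lra.
    rewrite mulr0 => /cvgrPdist_le/(_ _ e0)[j _ Hj]; exists (maxn i j).
    rewrite leq_maxl; split => //; have := Hj (maxn i j) (leq_maxr _ _).
    by rewrite sub0r normrN => /(le_trans (ler_norm _)).
  rewrite -(subnKC ij) in Hj.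
  have -> : f x - F x i = - (F x (i + (j - i))%N - f x) + (F x (i + (j - i))%N - F x i) by ring.
  apply: le_trans (ler_normD _ _) _; rewrite normrN addrC; apply: lerD.
    apply: le_trans (tele _ _ _) _; rewrite gerBl.
    by rewrite !mulr_ge0 ?exprn_ge0//; lra.
  by apply: le_trans Hj; exact: mean_ball_near.
move=> k x y xy.
have cross : `|F y k.+1 - F x k| <= CD ^+ 2 * (K0 * (3 / 4) ^+ k).
  apply: le_trans (ler_wpM2l (sqr_ge0 _) (osc_le x k)).
  have half : (2^-1 ^+ k : R) = 2 * 2^-1 ^+ k.+1 by rewrite exprS mulrA divff// mul1r.
  apply: mean_dist_le_mean => //.
    move=> z; rewrite !ballEmdist /= half => yz.
    by have := metric_triangle x y z; lra.
  exact: vol_ball_gt0.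
  apply: (@le_trans _ _ (vol (ball y (2 * 2^-1 ^+ k)))).
    apply: vol_le => // z; rewrite !ballEmdist /= => xz.
    have := metric_triangle y x z; rewrite (metric_sym y x) => /le_lt_trans; apply.
    by move: xz xy (r0 k.+1); rewrite half; move: (2^-1 ^+ k.+1) => q; lra.
  apply: le_trans (dbl y _ (r0 k)) _; rewrite expr2 -mulrA ler_pM2l//.
  by have := dbl y _ (r0 k.+1); rewrite -half.
have -> : f x - f y = (f x - F x k) - (F y k.+1 - F x k) - (f y - F y k.+1) by ring.
apply: le_trans (ler_normB _ _) _.
apply: le_trans (lerD (ler_normB _ _) (lexx _)) _.
apply: le_trans (lerD (lerD (lim x k) cross) (lim y k.+1)) _.
have q0 : 0 <= CD * K0 * (3 / 4) ^+ k by rewrite !mulr_ge0 ?exprn_ge0//; lra.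
rewrite [(3 / 4) ^+ k.+1]exprS; move: q0; move: ((3 / 4) ^+ k) => a; lra.
Qed.
End morrey.

(** * Limits along ultrafilters, and separation of disjoint supports *)

Section ultralimit.
Context {R : realType} {d : measure_display} {X : borelMetricType R d}.
Hypothesis compactX : compact [set: X].
Implicit Types (f g h u v w : X -> R) (x y : X) (e : R).

Lemma ultra_bounded_cvg (T : Type) (U : set_system T) (u : T -> R) M :
  UltraFilter U -> U [set t | `|u t| <= M] ->
  exists l, forall e, 0 < e -> U [set t | `|u t - l| <= e].
Proof.
move=> UU UM; have PU := ultra_proper (F:=U).
have cM := @segment_compact R (- M) M.
have [l [_ cl]] : `[- M, M]%classic `&` cluster (u @ U) !=set0.
  apply: cM; apply: (@filterS _ U _ [set t | `|u t| <= M]) => // t /=.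
  by rewrite /= in_itv /= ler_norml.
exists l => e e0.
have [//|UN] := in_ultra_setVsetC [set t | `|u t - l| <= e] UU.
have nl : nbhs l [set s | `|s - l| <= e].
  by apply/nbhs_ballP; exists e => //= s; rewrite /ball /= distrC => /ltW.
have [|s [us sl]] := cl (~` [set s | `|s - l| <= e]) _ _ nl; first exact: UN.
by [].
Qed.

(** The Arzela-Ascoli theorem, with a limit along an ultrafilter in place of a
    convergent subsequence. *)
Lemma equicontinuous_ultralimit (T : Type) (U : set_system T) (g : T -> X -> R) M :
  UltraFilter U -> U [set t | forall x, `|g t x| <= M] ->
  (forall e, 0 < e -> exists2 r, 0 < r &
    U [set t | forall x y, mdist x y < r -> `|g t x - g t y| <= e]) ->
  exists f : X -> R, continuous f /\
    forall e, 0 < e -> U [set t | forall x, `|g t x - f x| <= e].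
Proof.
move=> UU UM equi; have PU := ultra_proper (F:=U).
have lim x : exists l, forall e, 0 < e -> U [set t | `|g t x - l| <= e].
  by apply: (@ultra_bounded_cvg _ _ _ M); apply: filterS UM => t; apply.
have [f Hf] := choice lim.
have modulus e : 0 < e -> exists2 r, 0 < r &
    U [set t | forall x y, mdist x y < r -> `|g t x - g t y| <= e] /\
    forall x y, mdist x y < r -> `|f x - f y| <= e.
  move=> e0; have e3 : 0 < e / 3 by lra.
  have [r r0 Ur] := equi _ e3; exists r => //; split.
    by apply: filterS Ur => t Ut x y xy; apply: le_trans (Ut x y xy) _; lra.
  move=> x y xy.
  have [t [[Ut Ux] Uy]] := filter_ex (filterI (filterI Ur (Hf x _ e3)) (Hf y _ e3)).
  have -> : f x - f y = (g t x - g t y) - (g t x - f x) + (g t y - f y) by ring.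
  apply: le_trans (ler_normD _ _) _; apply: le_trans (lerD (ler_normB _ _) (lexx _)) _.
  by have := Ut _ _ xy; move: Ux Uy => /=; lra.
exists f; split.
  move=> x; apply/cvgrPdist_le => e e0; have [r r0 [_ fr]] := modulus _ e0.
  apply/nbhs_ballP; exists r => //= y; rewrite ballEmdist /=; exact: fr.
move=> e e0; have e3 : 0 < e / 3 by lra.
have [r r0 [Ur fe]] := modulus _ e3.
have /compact_near_coveringP cX := compactX.
have : \forall t \near U, [set: X] `<=` [set x | `|g t x - f x| <= e].
  apply: (cX _ U (fun t x => `|g t x - f x| <= e)) => x _.
  exists (ball x r, [set t | (forall x y, mdist x y < r -> `|g t x - g t y| <= e / 3)
     /\ `|g t x - f x| <= e / 3]).
    by split; [exact: nbhsx_ballx|exact: (filterI Ur (Hf x _ e3))].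
  move=> [y t] /= []; rewrite ballEmdist /= => xy [gt gx].
  have -> : g t y - f y = - (g t x - g t y) + (g t x - f x) + (f x - f y) by ring.
  apply: le_trans (ler_normD _ _) _; apply: le_trans (lerD (ler_normD _ _) (lexx _)) _.
  by rewrite normrN; have := gt _ _ xy; have := fe _ _ xy; lra.
by apply: filterS => t H x; exact: H.
Qed.

End ultralimit.

Section geodesic_separation.
Context {R : realType} {d : measure_display} {X : borelMetricType R d}.
Implicit Types (f g : X -> R) (x y : X).

(** On a geodesic from [x] to [y] the functions [f] and [g], whose supports are
    disjoint, vanish together somewhere in between. *)
Lemma disjoint_lipschitz_dist f g c x y : geodesic X -> 0 <= c ->
  lipschitz_with c f -> lipschitz_with c g -> (forall z, f z * g z = 0) ->
  f x != 0 -> g y != 0 -> `|f x| + `|g y| <= c * mdist x y.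
Proof.
move=> geo c0 fc gc fg fx gy.
have gx0 : g x = 0 by move/eqP: (fg x); rewrite mulf_eq0 (negbTE fx) => /eqP.
have fy0 : f y = 0 by move/eqP: (fg y); rewrite mulf_eq0 (negbTE gy) orbF => /eqP.
have [s [cs s0 s1 sd]] := geo x y.
pose phi t := `|f (s t)| - `|g (s t)|.
have cphi : {within `[0, 1], continuous phi}.
  have cF : continuous (fun z => `|f z| - `|g z|).
    move=> z; apply: cvgB; apply: cvg_norm; apply: lipschitz_continuous;
      by exists c.
  by move=> t; exact: (continuous_comp (cs t) (cF (s t))).
have [t t01 phit] : exists2 t, t \in `[0, 1] & phi t = 0.
  apply: IVT => //; rewrite /phi s0 s1 gx0 fy0 normr0 subr0 sub0r.
  by rewrite ge_min le_max normr_ge0 oppr_le0 normr_ge0 orbT.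
have fst : f (s t) = 0.
  move/eqP: (fg (s t)); rewrite mulf_eq0 => /orP[/eqP //|/eqP gst].
  by move: phit; rewrite /phi gst normr0 subr0 => /eqP; rewrite normr_eq0 => /eqP.
have gst : g (s t) = 0.
  by move: phit; rewrite /phi fst normr0 sub0r => /eqP; rewrite oppr_eq0 normr_eq0 => /eqP.
have t0 : (0 : R) \in `[0, 1] by rewrite in_itv /= lexx ler01.
have t1 : (1 : R) \in `[0, 1] by rewrite in_itv /= lexx ler01.
have /andP[tge0 tle1] : 0 <= t <= 1 by move: t01; rewrite in_itv.
have d1 : mdist x (s t) = mdist x y * t.
  by rewrite -{1}s0 sd// sub0r normrN ger0_norm.
have d2 : mdist (s t) y = mdist x y * (1 - t).
  by rewrite -{1}s1 sd// distrC ger0_norm// subr_ge0.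
have := fc x (s t); have := gc (s t) y; rewrite fst gst subr0 sub0r normrN d1 d2.
by move: (mdist x y) `|f x| `|g y| => D a b; lra.
Qed.

Lemma pack_ge (n : nat) (x : 'I_n -> X) b :
  (forall i j, i != j -> 2 * b <= mdist (x i) (x j)) -> (b%:E <= pack X n)%E.
Proof.
move=> xb; rewrite /pack -[X in (X <= _)%E](_ : (2^-1)%:E * (2 * b)%:E = _)%E; last first.
  by rewrite -EFinM mulrA mulVf// mul1r.
rewrite lee_pmul2l//; apply: le_trans (ereal_sup_ubound _); last by exists x.
apply: (big_ind (fun z => ((2 * b)%:E <= z)%E)); first exact: leey.
- by move=> u v; rewrite le_min => -> ->.
- by move=> ij /xb; rewrite lee_fin.
Qed.

Lemma lt_pack (n : nat) b : (b%:E < pack X n)%E ->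
  exists x : 'I_n -> X, forall i j, i != j -> 2 * b < mdist (x i) (x j).
Proof.
rewrite /pack -[X in (X < _)%E](_ : (2^-1)%:E * (2 * b)%:E = _)%E; last first.
  by rewrite -EFinM mulrA mulVf// mul1r.
rewrite lte_pmul2l// => /ereal_sup_gt[_ [x _ <-]] H; exists x => i j ij.
by rewrite -lte_fin; apply: lt_le_trans H _; apply: (bigmin_le_cond _ (j := (i, j))).
Qed.

End geodesic_separation.

Section energy_limit.
Context {R : realType} {d : measure_display} {X : borelMetricType R d}.
Variable m : probability X R.
Hypothesis compactX : compact [set: X].
Implicit Types (f g h u v w : X -> R) (x y : X) (e : R).
Local Notation L2 := (Lfun m 2%:E).
Local Notation sqn := (sqn m).

(** The part of the slopes exceeding [c'] is negligible in [L2]: its squared norm is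
    at most [c' ^ 2 * (c / c') ^ p], which tends to [0] as [p] grows. *)
Lemma strong_gradient_energy_limit f c c' : 0 < c -> c < c' -> f \in L2 ->
  (forall e P, 0 < e -> exists p w, [/\ P <= p, is_lipschitz w,
     \int[m]_x (lip w x `^ p) <= c `^ p & forall x, `|w x - f x| <= e]) ->
  strong_gradient m f (cst c').
Proof.
move=> c0 cc' f2 H e e0; have c'0 : 0 < c' by apply: lt_trans cc'.
pose q := c / c'; have q0 : 0 < q by exact: divr_gt0.
have q1 : q < 1 by rewrite ltr_pdivrMr// mul1r.
have [n Hn] : exists n, c' ^+ 2 * q ^+ n <= e.
  have : c' ^+ 2 * q ^+ n @[n --> \oo] --> c' ^+ 2 * 0.
    by apply: cvgM; [exact: cvg_cst|apply: cvg_expr; rewrite ger0_norm// ltW].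
  rewrite mulr0 => /cvgrPdist_le/(_ _ e0)[n _ Hn]; exists n.
  by have := Hn n (leqnn _); rewrite sub0r normrN => /(le_trans (ler_norm _)).
have e1 : 0 < Num.min 1 e by rewrite lt_min ltr01.
have [p [w [Pp Lw wc wf]]] := H _ (Num.max 2 n%:R) e1.
move: Pp; rewrite ge_max => /andP[p2 np].
have p0 : 0 < p by apply: lt_le_trans p2.
have [L L0 wL] := is_lipschitzW Lw.
have l0 x := lip_ge0 x Lw.
have lL x : lip w x <= L by exact: lip_le.
have ml := measurable_lip Lw.
pose G x := Num.max (lip w x) c'.
have mG : measurable_fun setT G by apply: measurable_maxr.
have G2 : G \in L2.
  apply: (@L2_bounded _ _ _ _ _ (L + c')) => // x; rewrite ger0_norm ?le_max ?l0//.
  by rewrite ge_max; have := lL x; lra.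
exists w, G; split => //.
- apply: le_trans (_ : sqn (fun x => Num.min 1 e) <= _).
    apply: le_sqn => //.
    + by apply: L2B => //; exact: lipschitz_L2.
    + exact: Lfun_cst.
    + by move=> x; rewrite [leRHS]gtr0_norm.
  rewrite /sqn Rintegral_cst// [X in fine X](_ : _ = 1%E) ?mulr1; last exact: probability_setT.
  apply: le_trans (_ : 1 * Num.min 1 e <= _); last by rewrite mul1r ge_min lexx orbT.
  by rewrite expr2 ler_pM2r// ge_min lexx.
- by apply: nearW => x; rewrite le_max lexx.
- have int : m.-integrable setT (EFin \o (fun x => lip w x `^ p)).
    apply: (@bounded_integrable _ _ _ _ _ (L `^ p)) => //.
      exact: (measurableT_comp (measurable_powR _)).
    by move=> x; rewrite ger0_norm ?powR_ge0// ge0_ler_powR ?nnegrE//; exact: ltW.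
  have GC2 : (fun x => G x - c') \in L2 by apply: L2B => //; exact: Lfun_cst.
  apply: le_trans (_ : \int[m]_x (c' ^+ 2 * c'^-1 `^ p * lip w x `^ p) <= _).
    apply: le_Rintegral => //; first exact: L2_sqr_integrable.
      exact: (integrableZl measurableT (c' ^+ 2 * c'^-1 `^ p) int).
    move=> x _; rewrite -mulrA -powRM ?invr_ge0 ?(ltW c'0)// /G /=.
    have [lc|cl] := leP (lip w x) c'.
      by rewrite subrr expr0n /= mulr_ge0 ?sqr_ge0 ?powR_ge0.
    have s1 : 1 <= c'^-1 * lip w x by rewrite mulrC ler_pdivlMr// mul1r ltW.
    apply: le_trans (_ : c' ^+ 2 * (c'^-1 * lip w x) `^ 2 <= _).
      rewrite powR_mulrn; last by apply: le_trans s1.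
      by rewrite -exprMn mulrA divff ?gt_eqF// mul1r lerXn2r ?nnegrE//; lra.
    by rewrite ler_wpM2l ?sqr_ge0//; exact: ler_powR.
  rewrite RintegralZl//; apply: le_trans Hn.
  apply: le_trans (ler_wpM2l _ wc) _; first by rewrite mulr_ge0 ?sqr_ge0 ?powR_ge0.
  rewrite -mulrA ler_wpM2l ?sqr_ge0//.
  rewrite -powRM ?invr_ge0 ?(ltW c'0) ?(ltW c0)// [_ * c]mulrC -/q -powR_mulrn ?(ltW q0)//.
  by apply: ger_powR => //; rewrite q0 ltW.
Qed.

End energy_limit.

(** * Dirichlet eigenvalues *)

Section dirichlet_eigenvalues.
Context {R : realType} {d : measure_display} {X : borelMetricType R d}.
Variable m : probability X R.
Hypothesis compactX : compact [set: X].
Hypothesis supp_m : full_support m.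
Implicit Types (f g h u v w : X -> R) (x y : X) (e p c : R).

Lemma powR_bounded_integrable h M p : 0 < p -> measurable_fun setT h ->
  (forall x, `|h x| <= M) -> m.-integrable setT (EFin \o (fun x => `|h x| `^ p)).
Proof.
move=> p0 mh hM; apply: (@bounded_integrable _ _ _ _ _ (M `^ p)) => //.
  by apply: (measurableT_comp (measurable_powR _)); exact: measurableT_comp.
move=> x; rewrite ger0_norm ?powR_ge0// ge0_ler_powR ?nnegrE ?(ltW p0)//.
by apply: le_trans (hM x).
Qed.

Lemma Lnorm_powR_bounded h M p : 0 < p -> measurable_fun setT h ->
  (forall x, `|h x| <= M) ->
  ('N[m]_p%:E[EFin \o h] `^ p = (\int[m]_x (`|h x| `^ p))%:E)%E.
Proof.
move=> p0 mh hM; rewrite poweR_Lnorm ?gt_eqF// /Rintegral fineK.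
  by apply: eq_integral => x _.
by apply: integrable_fin_num => //; exact: powR_bounded_integrable hM.
Qed.

Lemma integral_powR_ball f M p x r a : 0 < p -> 0 <= a -> measurable_fun setT f ->
  (forall x, `|f x| <= M) -> (forall y, mdist x y < r -> a <= `|f y|) ->
  a `^ p * fine (m (ball x r)) <= \int[m]_x (`|f x| `^ p).
Proof.
move=> p0 a0 mf fM fa; have mB := measurable_ballX x r.
rewrite -Rintegral_cst//; have fi := powR_bounded_integrable p0 mf fM.
apply: (@le_trans _ _ (\int[m]_(x in ball x r) (`|f x| `^ p))).
  apply: le_Rintegral => //.
  - exact: (@bounded_integrable _ _ _ _ _ `|a `^ p|).
  - exact: integrableS fi.
  - move=> y; rewrite ballEmdist /= => /fa ay; apply: ge0_ler_powR => //; exact: ltW.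
by apply: Rintegral_subset => // y; exact: powR_ge0.
Qed.

Lemma energy_gt0 f p : 0 < p -> is_lipschitz f -> f != cst 0 ->
  0 < \int[m]_x (`|f x| `^ p).
Proof.
move=> p0 Lf f0; have [M M0 fM] := compact_lipschitz_bounded compactX Lf.
have [x fx] : exists x, f x != 0.
  apply: contrapT => H; move/eqP: f0; apply; apply/funext => x /=.
  by apply: contrapT => /eqP fx; apply: H; exists x.
have [C C0 fC] := lipschitz_with_gt0 Lf.
have fx0 : 0 < `|f x| by rewrite normr_gt0.
pose r := `|f x| / 2 / C; have r0 : 0 < r by rewrite !divr_gt0.
apply: lt_le_trans (@integral_powR_ball f M p x r (`|f x| / 2) p0 _ _ fM _).
- by rewrite mulr_gt0 ?powR_gt0 ?divr_gt0 ?ball_measure_gt0.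
- by rewrite divr_ge0.
- exact: measurable_lipschitz.
- move=> y xy; have := fC x y; have : C * mdist x y <= `|f x| / 2.
    by rewrite mulrC -ler_pdivlMr// ltW.
  have := ler_normD (f x - f y) (f y); rewrite subrK; lra.
Qed.

Lemma rayleigh_quotientE f p : 0 < p -> is_lipschitz f -> f != cst 0 ->
  ('N[m]_p%:E[EFin \o lip f] `^ p / 'N[m]_p%:E[EFin \o f] `^ p)%E =
  (\int[m]_x (lip f x `^ p) / \int[m]_x (`|f x| `^ p))%:E.
Proof.
move=> p0 Lf f0; have [M M0 fM] := compact_lipschitz_bounded compactX Lf.
have [L L0 fL] := is_lipschitzW Lf.
rewrite (@Lnorm_powR_bounded _ L)//; first last.
- by move=> x; rewrite ger0_norm ?lip_ge0//; exact: lip_le.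
- exact: measurable_lip.
rewrite (@Lnorm_powR_bounded _ M)//; last exact: measurable_lipschitz.
have E0 := energy_gt0 p0 Lf f0.
have -> : \int[m]_x (`|lip f x| `^ p) = \int[m]_x (lip f x `^ p).
  by apply: eq_Rintegral => x _; rewrite ger0_norm ?lip_ge0.
by rewrite inver gt_eqF// -EFinM.
Qed.

(** A Rayleigh quotient at most [c ^ p], with the denominator replaced by the uniform
    norm: this is the normalization that survives the limit in [p]. *)
Definition normalized_test p c g := [/\ is_lipschitz g, forall x, `|g x| <= 1,
  exists x, `|g x| = 1 & \int[m]_x (lip g x `^ p) <= c `^ p].

(** Divide a test function by its maximum [`|f x|]: its [p]-norm is at most that
    maximum because [m] is a probability. *)
Lemma dirichlet_lt_test p c (A : set X) : 0 < p -> 0 < c ->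
  (dirichlet_lambda m p A < (c `^ p)%:E)%E ->
  exists g, normalized_test p c g /\ forall x, ~ A x -> g x = 0.
Proof.
move=> p0 c0 /ereal_inf_lt[_ [f [[Lf cf fA] f0] <-]].
have {}f0 : f != cst 0 by apply/eqP => E; exact: f0.
rewrite rayleigh_quotientE// lte_fin => fc.
have [x _ xmax] : exists2 x, x \in [set: X] & forall y, y \in [set: X] -> `|f y| <= `|f x|.
  apply: (@compact_EVT_max _ _ (fun y => `|f y|)) => //.
    apply: contrapT => X0; move/eqP: f0; apply; apply/funext => y.
    by exfalso; apply: X0; exists y.
  by apply: continuous_subspaceT => y; apply: cvg_norm; exact: lipschitz_continuous.
have {}xmax y : `|f y| <= `|f x| by apply: xmax; rewrite inE.
have fx0 : 0 < `|f x|.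
  rewrite lt_neqAle normr_ge0 andbT eq_sym; apply: contra f0 => /eqP fx.
  apply/eqP/funext => y; apply/eqP; rewrite -normr_le0.
  by apply: le_trans (xmax y) _; rewrite fx.
pose a := `|f x|^-1; have a0 : 0 < a by rewrite invr_gt0.
have Lg : is_lipschitz (fun y => a * f y) by have [] := lip_scale a x Lf.
have [L L0 fL] := is_lipschitzW Lf.
exists (fun y => a * f y); split; last first.
  move=> y Ay; apply/eqP; rewrite mulf_eq0; apply/orP; right; apply: contrapT => fy.
  by apply: Ay; apply: fA; apply: subset_closure => /=; exact/negP.
split => //.
- by move=> y; rewrite normrM (gtr0_norm a0) mulrC ler_pdivrMr// mul1r.
- by exists x; rewrite normrM (gtr0_norm a0) mulVf// gt_eqF.
have ml := measurable_lip Lf.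
have li : m.-integrable setT (EFin \o (fun y => lip f y `^ p)).
  rewrite (_ : (fun y => _) = (fun y => `|lip f y| `^ p)).
    apply: (@powR_bounded_integrable _ L) => // y.
    by rewrite ger0_norm ?lip_ge0//; exact: lip_le.
  by apply/funext => y; rewrite ger0_norm ?lip_ge0.
have [D D0 gD] := is_lipschitzW Lg.
have lig : m.-integrable setT (EFin \o (fun y => lip (fun z => a * f z) y `^ p)).
  rewrite (_ : (fun y => _) = (fun y => `|lip (fun z => a * f z) y| `^ p)).
    apply: (@powR_bounded_integrable _ D) => //; first exact: measurable_lip.
    by move=> y; rewrite ger0_norm ?lip_ge0//; exact: lip_le.
  by apply/funext => y; rewrite ger0_norm ?lip_ge0.
apply: (@le_trans _ _ (a `^ p * \int[m]_y (lip f y `^ p))).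
  rewrite -(RintegralZl (a `^ p) measurableT li); apply: le_Rintegral => //.
    exact: (integrableZl measurableT (a `^ p) li).
  move=> y _; rewrite -powRM ?(ltW a0) ?lip_ge0//.
  apply: ge0_ler_powR; rewrite ?nnegrE ?(ltW p0) ?lip_ge0 ?mulr_ge0 ?(ltW a0) ?lip_ge0//.
  by have [_] := lip_scale a y Lf; rewrite (gtr0_norm a0).
move: fc; rewrite ltr_pdivrMr ?energy_gt0// => /ltW fc.
apply: le_trans (ler_wpM2l (powR_ge0 _ _) fc) _.
rewrite mulrCA ler_piMr ?powR_ge0//.
have fi := powR_bounded_integrable p0 (measurable_lipschitz Lf) xmax.
rewrite -(RintegralZl (a `^ p) measurableT fi); apply: (@le_trans _ _ (\int[m]_(y in [set: X]) 1)).
  apply: le_Rintegral => //.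
  - exact: (integrableZl measurableT (a `^ p) fi).
  - exact: (@bounded_integrable _ _ _ _ _ `|1|).
  - move=> y _; rewrite -powRM ?(ltW a0)//.
    apply: le_trans (_ : 1 `^ p <= 1); last by rewrite powR1.
    apply: ge0_ler_powR; rewrite ?nnegrE ?(ltW p0) ?mulr_ge0 ?(ltW a0)//.
    by rewrite mulrC ler_pdivrMr// mul1r.
by rewrite Rintegral_cst// [X in fine X](_ : _ = 1%E) ?mulr1; last exact: probability_setT.
Qed.

Lemma dirichlet_lambda_ge0 p (A : set X) : (0 <= dirichlet_lambda m p A)%E.
Proof.
apply: le_ereal_inf_tmp => _ [f _ <-]; apply: mule_ge0; first exact: poweR_ge0.
by rewrite inve_ge0 poweR_ge0.
Qed.

(** The test function is the cone of height [r] over the ball of radius [r]: its slope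
    is at most [1], and it exceeds [s] on the ball of radius [r - s]. *)
Lemma dirichlet_ball_le p x (r s t : R) : 0 < p -> 0 < s -> s < r -> r < t ->
  (dirichlet_lambda m p (ball x t) <= ((s `^ p * fine (m (ball x (r - s))))^-1)%:E)%E.
Proof.
move=> p0 s0 sr rt; have r0 : 0 < r by lra.
pose f y := Num.max (r - mdist x y) 0.
have f1 : lipschitz_with 1 f.
  move=> y z; rewrite mul1r /f ler_norml.
  have := metric_triangle x y z; have := metric_triangle x z y; rewrite (metric_sym z y).
  by have [?|?] := leP (r - mdist x y) 0; have [?|?] := leP (r - mdist x z) 0;
    have := mdist_ge0 y z; lra.
have Lf : is_lipschitz f by exists 1.
have f0 y : 0 <= f y by rewrite le_max lexx orbT.
have fr y : `|f y| <= r.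
  by rewrite ger0_norm// ge_max (ltW r0) andbT; have := mdist_ge0 x y; lra.
have fN0 : f != cst 0.
  apply/eqP => /(congr1 (fun F => F x)); rewrite /f mdistxx subr0 /= => /eqP.
  by rewrite max_l ?(ltW r0)// gt_eqF.
have cl : closure [set y | f y != 0] `<=` [set y | mdist x y <= r].
  have cB : closed [set y | mdist x y <= r].
    have -> : [set y | mdist x y <= r] = (fun y => mdist x y) @^-1` [set z | z <= r] by [].
    apply: closed_comp; last exact: closed_le.
    move=> y _; apply: lipschitz_continuous; exists 1 => u v; rewrite mul1r ler_norml.
    have := metric_triangle x u v; have := metric_triangle x v u.
    by rewrite (metric_sym v u); lra.
  rewrite [X in _ `<=` X](iffLR (closure_id _) cB); apply: closure_subset.
  move=> y /=; apply: contraNT; rewrite -ltNge => ry.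
  by apply/eqP; rewrite /f max_r//; lra.
have M := measurable_lipschitz Lf.
have low := integral_powR_ball (x := x) (r := r - s) p0 (ltW s0) M fr.
have {}low : s `^ p * fine (m (ball x (r - s))) <= \int[m]_x (`|f x| `^ p).
  apply: low => y xy; rewrite ger0_norm// le_max; apply/orP; left; lra.
have low0 : 0 < s `^ p * fine (m (ball x (r - s))).
  by rewrite mulr_gt0 ?powR_gt0 ?ball_measure_gt0// subr_gt0.
apply: ge_ereal_inf; exists ('N[m]_p%:E[EFin \o lip f] `^ p / 'N[m]_p%:E[EFin \o f] `^ p)%E.
  exists f => //; split; last by move=> E; rewrite E eqxx in fN0.
  split => //.
    by apply: subclosed_compact compactX _ => //; exact: closed_closure.
  by move=> y /cl; rewrite ballEmdist /= => /le_lt_trans; apply.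
rewrite rayleigh_quotientE// lee_fin.
apply: le_trans (_ : 1 / \int[m]_x (`|f x| `^ p) <= _); last first.
  by rewrite div1r lef_pV2 ?posrE// energy_gt0.
rewrite ler_pM2r ?invr_gt0 ?energy_gt0//.
apply: (@le_trans _ _ (\int[m]_(y in [set: X]) 1)).
  apply: le_Rintegral => //.
  - rewrite (_ : (fun y => _) = (fun y => `|lip f y| `^ p)).
      apply: (@powR_bounded_integrable _ 1) => //; first exact: measurable_lip.
      by move=> y; rewrite ger0_norm ?lip_ge0//; exact: lip_le.
    by apply/funext => y; rewrite ger0_norm ?lip_ge0.
  - exact: (@bounded_integrable _ _ _ _ _ `|1|).
  - move=> y _; apply: le_trans (_ : 1 `^ p <= 1); last by rewrite powR1.
    apply: ge0_ler_powR; rewrite ?nnegrE ?(ltW p0) ?lip_ge0//.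
    exact: lip_le.
by rewrite Rintegral_cst// [X in fine X](_ : _ = 1%E) ?mulr1; last exact: probability_setT.
Qed.

End dirichlet_eigenvalues.

(** * Asymptotics of the packing eigenvalues *)

Section eigenvalue_bounds.
Context {R : realType} {d : measure_display} {X : borelMetricType R d}.
Variable m : probability X R.
Hypothesis compactX : compact [set: X].
Hypothesis geodesicX : geodesic X.
Hypothesis supp_m : full_support m.
Implicit Types (f g h u v w : X -> R) (x y : X) (e p c : R).

Lemma powR_pinfty_ge (q v : R) : 1 < q -> \forall p \near +oo, v <= q `^ p.
Proof.
move=> q1; have lq : 0 < ln q by rewrite ln_gt0.
have q0 : 0 < q by lra.
have [v0|v0] := leP v 0.
  by apply: nearW => p; apply: le_trans v0 (powR_ge0 _ _).
exists (ln v / ln q); split; first exact: num_real.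
move=> p /ltW vp; rewrite -[v]lnK ?posrE// /powR gt_eqF// ler_expR.
by rewrite -ler_pdivrMr.
Qed.

(** Disjoint balls around a packing configuration, with the cones of
    [dirichlet_ball_le] as test functions. *)
Lemma lambda_max_le_near k (x : 'I_k.+1 -> X) (r b : R) : 0 < r -> r^-1 < b ->
  (forall i j, i != j -> 2 * r < mdist (x i) (x j)) ->
  \forall p \near +oo, (lambda_max m k p <= (b `^ p)%:E)%E.
Proof.
move=> r0 rb xr; have b0 : 0 < b by apply: lt_trans rb; rewrite invr_gt0.
have br : b^-1 < r by rewrite -[r]invrK ltf_pV2 ?posrE ?invr_gt0.
have b'0 : 0 < b^-1 by rewrite invr_gt0.
(* Any [s] and [r1] with [b^-1 < s < r1 < r] would do. *)
pose s := (2 * b^-1 + r) / 3; pose r1 := (b^-1 + 2 * r) / 3.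
have bs : b^-1 < s by rewrite /s; lra.
have sr1 : s < r1 by rewrite /s /r1; lra.
have r1r : r1 < r by rewrite /r1; lra.
have s0 : 0 < s by lra.
have bs1 : 1 < b * s by rewrite -ltr_pdivrMl// mulr1.
pose vol i := fine (m (ball (x i) (r1 - s))).
have vol0 i : 0 < vol i by apply: ball_measure_gt0; rewrite ?subr_gt0.
have fam : disjoint_open_families X k (fun i => ball (x i) r).
  split.
  - by move=> i; exact: open_ballX.
  - by move=> i; exists (x i); rewrite ballEmdist /= mdistxx.
  - move=> i j _ _ [z []]; rewrite !ballEmdist /= => iz jz.
    apply/eqP; apply: contrapT => /negP ij; have := xr _ _ ij.
    by have := metric_triangle (x i) z (x j); rewrite (metric_sym z); lra.
have big i : \forall p \near +oo, (vol i)^-1 <= (b * s) `^ p by exact: powR_pinfty_ge.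
have bigI : \forall p \near +oo, forall i, (vol i)^-1 <= (b * s) `^ p.
  exact: filter_forall.
near=> p.
have p0 : 0 < p by near: p; exact: nbhs_pinfty_gt (num_real _).
apply: ge_ereal_inf; eexists; first by exists (fun i => ball (x i) r).
apply: bigmax_le => [|i _]; first exact: leNye.
apply: le_trans (dirichlet_ball_le compactX supp_m (x i) p0 s0 sr1 r1r) _.
rewrite lee_fin -/(vol i) invfM ler_pdivrMl ?powR_gt0//.
rewrite mulrC -powRM ?(ltW b0) ?(ltW s0)//.
by have : forall i, (vol i)^-1 <= (b * s) `^ p by near: p; exact: bigI.
Unshelve. all: by end_near. Qed.

Lemma lambda_max_ge0 k p : (0 <= lambda_max m k p)%E.
Proof.
apply: le_ereal_inf_tmp => _ [A _ <-].
apply: le_trans (dirichlet_lambda_ge0 m p (A ord0)) _.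
exact: (le_bigmax _ (fun i => dirichlet_lambda m p (A i))).
Qed.

Lemma lambda_mean_le k p : (lambda_mean m k p <= lambda_max m k p)%E.
Proof.
rewrite /lambda_mean lee_pdivrMl//.
apply: (@le_trans _ _ (ereal_inf [set (k.+1%:R%:E * \big[maxe/-oo%E]_(i < k.+1) dirichlet_lambda m p (A i))%E
   | A in disjoint_open_families X k])).
  apply: le_ereal_inf_tmp => _ [A famA <-]; apply: ge_ereal_inf.
  exists (\sum_(i < k.+1) dirichlet_lambda m p (A i))%E; first by exists A.
  pose M := \big[maxe/-oo%E]_(i < k.+1) dirichlet_lambda m p (A i); rewrite -/M.
  apply: (@le_trans _ _ (\sum_(i < k.+1) M)%E).
    by apply: lee_sum => i _; exact: (le_bigmax _ (fun i => dirichlet_lambda m p (A i))).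
  by rewrite mule_natl sumr_const card_ord.
rewrite -lee_pdivrMl//; apply: le_ereal_inf_tmp => _ [A famA <-].
rewrite lee_pdivrMl//.
by apply: ereal_inf_lbound; exists A.
Qed.

Lemma lambda_mean_ge k p : ((k.+1%:R^-1)%:E * lambda_max m k p <= lambda_mean m k p)%E.
Proof.
rewrite /lambda_mean lee_pmul2l// ?lte_fin ?invr_gt0//.
apply: le_ereal_inf_tmp => _ [A famA <-]; apply: ge_ereal_inf.
exists (\big[maxe/-oo%E]_(i < k.+1) dirichlet_lambda m p (A i)); first by exists A.
apply: bigmax_le => [|i _]; first exact: leNye.
rewrite (bigD1 i)//= leeDl// sume_ge0// => j _; exact: dirichlet_lambda_ge0.
Qed.

Lemma lambda_max_lt_test k p c : 0 < p -> 0 < c ->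
  (lambda_max m k p < (c `^ p)%:E)%E ->
  exists g : 'I_k.+1 -> X -> R, (forall i, normalized_test m p c (g i)) /\
    forall i j, i != j -> forall x, g i x * g j x = 0.
Proof.
move=> p0 c0 /ereal_inf_lt[_ [A [oA A0 tA] <-]] Alt.
have ex i : exists g, normalized_test m p c g /\ forall x, ~ A i x -> g x = 0.
  apply: dirichlet_lt_test => //; apply: le_lt_trans Alt.
  exact: (le_bigmax _ (fun i => dirichlet_lambda m p (A i))).
have [g Hg] := choice ex; exists g; split; first by move=> i; have [] := Hg i.
move=> i j ij x; have [_ gi] := Hg i; have [_ gj] := Hg j.
have [Ai|Ai] := pselect (A i x); last by rewrite gi// mul0r.
rewrite (gj x) ?mulr0// => Aj; move/eqP: ij; apply.
by apply: tA => //; exists x.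
Qed.

(** The limit of [k + 1] disjoint normalized test functions with Rayleigh quotients
    below [c ^ p] consists of [k + 1] functions that are [c']-Lipschitz for every
    [c' > c], with disjoint supports and maxima close to [1]: points where they are
    nearly maximal form a packing with constant nearly [c ^ -1]. *)
Lemma pack_ge_of_frequently_lt k c b :
  doubling m -> poincare m -> sobolev_to_lipschitz m ->
  0 < c -> 0 < b -> b < c^-1 ->
  (forall n : nat, exists2 p, n%:R < p & (lambda_max m k p < (c `^ p)%:E)%E) ->
  (b%:E <= pack X k.+1)%E.
Proof.
move=> dbl poin stl c0 b0 bc H.
have cb : c < b^-1 by rewrite -[c]invrK ltf_pV2 ?posrE ?invr_gt0.
(* [c1] lies strictly between [c] and [b^-1]. *)
pose c1 := (2 * c + b^-1) / 3.
have cc1 : c < c1 by rewrite /c1; lra.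
have c1b : c1 < b^-1 by rewrite /c1; lra.
have c10 : 0 < c1 by lra.
have bc1 : b * c1 < 1 by rewrite mulrC -ltr_pdivlMr// mul1r.
pose e := 1 - b * c1; have e0 : 0 < e by rewrite subr_gt0.
have e1 : 1 - e = b * c1 by rewrite /e; ring.
have bc10 : 0 < b * c1 by rewrite mulr_gt0.
have ex n : exists pg : R * ('I_k.+1 -> X -> R), [/\ n%:R < pg.1,
    forall i, normalized_test m pg.1 c (pg.2 i) &
    forall i j, i != j -> forall x, pg.2 i x * pg.2 j x = 0].
  have [p np lt] := H n; have p0 : 0 < p by apply: le_lt_trans np.
  by have [g [g1 g2]] := lambda_max_lt_test p0 c0 lt; exists (p, g).
have [pg Hpg] := choice ex; pose P n := (pg n).1; pose g n := (pg n).2.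
have nP n : n%:R < P n by have [] := Hpg n.
have tg n i : normalized_test m (P n) c (g n i) by have [_ + _] := Hpg n; apply.
have dg n i j : i != j -> forall x, g n i x * g n j x = 0.
  by have [_ _ +] := Hpg n; apply.
have [U [UU Uoo]] := @ultraFilterLemma nat \oo _.
have PU := ultra_proper (F:=U).
have UP (Q : R) : U [set n | Q <= P n].
  apply: Uoo; exists (Num.bound `|Q|) => // n /= Qn.
  apply: le_trans (ler_norm Q) _; apply: ltW; apply: lt_trans (nP n).
  by apply: lt_le_trans (archi_boundP (normr_ge0 Q)) _; rewrite ler_nat.
have [p1 [K morrey]] := morrey_modulus compactX supp_m c0 dbl poin.
have lim i : exists f : X -> R, continuous f /\
    forall e, 0 < e -> U [set n | forall x, `|g n i x - f x| <= e].
  apply: (@equicontinuous_ultralimit _ _ _ compactX _ U (fun n => g n i) 1) => //.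
    by apply: filterS (UP 0) => n _; have [] := tg n i.
  move=> r r0.
  have [j Hj] : exists j, K * (3 / 4) ^+ j <= r.
    have : K * (3 / 4) ^+ j @[j --> \oo] --> K * 0.
      by apply: cvgM; [exact: cvg_cst|apply: cvg_expr; rewrite ger0_norm; lra].
    rewrite mulr0 => /cvgrPdist_le/(_ _ r0)[j _ Hj]; exists j.
    by have := Hj j (leqnn _); rewrite /= sub0r normrN => /(le_trans (ler_norm _)).
  exists (2^-1 ^+ j.+1); first by rewrite exprn_gt0// invr_gt0.
  apply: filterS (UP p1) => n /= pn x y xy.
  have [Lg _ _ eg] := tg n i.
  by apply: le_trans Hj; exact: morrey pn Lg eg _ _ _ xy.
have [f Hf] := choice lim.
have cf i : continuous (f i) by have [] := Hf i.
have uf i : forall e, 0 < e -> U [set n | forall x, `|g n i x - f i x| <= e].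
  by have [] := Hf i.
have flip i : lipschitz_with c1 (f i).
  apply: (@strong_gradient_lipschitz _ _ _ m compactX) => //; first exact: ltW.
  have [n Hn] := filter_ex (uf i _ ltr01).
  apply: (strong_gradient_energy_limit compactX c0 cc1).
    apply: (@L2_bounded _ _ _ _ _ 2); first exact: continuous_measurable_borel.
    move=> x; have [_ g1 _ _] := tg n i; have := g1 x; have := Hn x.
    have := ler_normB (g n i x) (g n i x - f i x).
    by rewrite opprB addrC subrK; lra.
  move=> r Q r0; have [n' [Qn Hn']] := filter_ex (filterI (UP Q) (uf i _ r0)).
  by exists (P n'), (g n' i); have [] := tg n' i.
have fdisj i j z : i != j -> f i z * f j z = 0.
  move=> ij; apply/eqP; rewrite mulf_eq0; apply: contrapT => /negP.
  rewrite negb_or => /andP[fi fj].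
  have s0 : 0 < Num.min `|f i z| `|f j z| / 2 by rewrite divr_gt0// lt_min !normr_gt0 fi.
  have [n [Hi Hj]] := filter_ex (filterI (uf i _ s0) (uf j _ s0)).
  have := Hi z; have := Hj z; move/eqP: (dg n _ _ ij z); rewrite mulf_eq0.
  have mi : Num.min `|f i z| `|f j z| <= `|f i z| by rewrite ge_min lexx.
  have mj : Num.min `|f i z| `|f j z| <= `|f j z| by rewrite ge_min lexx orbT.
  move=> /orP[] /eqP ->; rewrite sub0r normrN; move: (normr_gt0 (f i z)) (normr_gt0 (f j z)); rewrite fi fj; lra.
have pts : exists x : 'I_k.+1 -> X, forall i, 1 - e <= `|f i (x i)|.
  have ptsi i : exists x, 1 - e <= `|f i x|.
    have [n Hn] := filter_ex (uf i _ e0); have [_ _ [x gx] _] := tg n i.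
    exists x; have := Hn x; have := ler_normD (g n i x - f i x) (f i x).
    by rewrite subrK gx; lra.
  by have [x Hx] := choice ptsi; exists x.
have [x Hx] := pts; apply: (@pack_ge _ _ _ _ x) => i j ij.
have fN0 l : f l (x l) != 0 by rewrite -normr_gt0; apply: lt_le_trans (Hx l); rewrite e1.
have := disjoint_lipschitz_dist geodesicX (ltW c10) (flip i) (flip j) (fun z => fdisj i j z ij) (fN0 i) (fN0 j).
have := Hx i; have := Hx j; rewrite e1 => hj hi sep.
by rewrite -(ler_pM2l c10); apply: le_trans sep; lra.
Qed.

Lemma lambda_max_ge_near k c : doubling m -> poincare m -> sobolev_to_lipschitz m ->
  0 < c -> (pack X k.+1 < (c^-1)%:E)%E ->
  \forall p \near +oo, ((c `^ p)%:E <= lambda_max m k p)%E.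
Proof.
move=> dbl poin stl c0 packc; apply: contrapT.
move/(not_near_inftyP (fun p => ((c `^ p)%:E <= lambda_max m k p)%E)) => H.
have [b [b0 bc packb]] : exists b, [/\ 0 < b, b < c^-1 & (pack X k.+1 < b%:E)%E].
  have c'0 : 0 < c^-1 by rewrite invr_gt0.
  case: (pack X k.+1) packc => [r| |]//.
    rewrite lte_fin => rc; exists ((Num.max r 0 + c^-1) / 2).
    by rewrite lte_fin; split; have [?|?] := leP r 0; lra.
  by move=> _; exists (c^-1 / 2); rewrite ltNyr; split => //; lra.
have := @pack_ge_of_frequently_lt k c b dbl poin stl c0 b0 bc.
rewrite leNgt packb => F; suff: false by []; apply: F => n.
by have [p np /negP] := H n%:R (num_real _); rewrite -ltNge; exists p.
Qed.

Lemma root_cvg (L : R -> \bar R) (l : \bar R) : (0 <= l)%E ->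
  (forall p, 0 <= L p)%E ->
  (forall c, 0 < c -> (c%:E < l)%E -> \forall p \near +oo, ((c `^ p)%:E <= L p)%E) ->
  (forall b, (l < b%:E)%E -> \forall p \near +oo, (L p <= (b `^ p)%:E)%E) ->
  (L p `^ p^-1)%E @[p --> +oo%R] --> l.
Proof.
move=> l0 L0 low up.
have root p (a b : \bar R) : 0 < p -> (0 <= a)%E -> (a <= b)%E -> (a `^ p^-1 <= b `^ p^-1)%E.
  move=> p0 a0 ab; apply: gt0_ler_poweR => //; first by rewrite invr_ge0 ltW.
    by rewrite in_itv /= a0 leey.
  by rewrite in_itv /= leey andbT; exact: le_trans ab.
have rootE p c : 0 < p -> 0 <= c -> ((c `^ p)%:E `^ p^-1 = c%:E)%E.
  by move=> p0 c0; rewrite poweR_EFin -powRrM divff ?gt_eqF// powRr1.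
have low' c : (c%:E < l)%E -> \forall p \near +oo, (c%:E <= L p `^ p^-1)%E.
  move=> cl; have [c0|c0] := leP c 0.
    by apply: nearW => p; apply: le_trans (poweR_ge0 _ _); rewrite lee_fin.
  have lc := low _ c0 cl; near=> p.
  have p0 : 0 < p by near: p; exact: nbhs_pinfty_gt (num_real _).
  rewrite -(rootE p c)// ?(ltW c0)//; apply: root => //; first by rewrite lee_fin powR_ge0.
  by near: p.
have up' b : (l < b%:E)%E -> \forall p \near +oo, (L p `^ p^-1 <= b%:E)%E.
  move=> lb; have b0 : 0 <= b by rewrite -lee_fin; apply: le_trans l0 (ltW lb).
  have ub := up _ lb; near=> p.
  have p0 : 0 < p by near: p; exact: nbhs_pinfty_gt (num_real _).
  rewrite -[leRHS](rootE p b)//; apply: root => //.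
  by near: p.
case: l l0 low up low' up' => [r| |]// r0 _ _ low' up'; last first.
  by apply/cvgeyPge => A; apply: low'; rewrite ltry.
apply/fine_cvgP; split.
  have ub := up' (r + 1); near=> p.
  rewrite ge0_fin_numE ?poweR_ge0//; apply: le_lt_trans (ltry (r + 1)).
  by near: p; apply: ub; rewrite lte_fin ltrDl.
apply/cvgrPdist_le => e e0.
have lb := low' (r - e); have ub := up' (r + e).
near=> p.
have h1 : ((r - e)%:E <= L p `^ p^-1)%E by near: p; apply: lb; rewrite lte_fin; lra.
have h2 : (L p `^ p^-1 <= (r + e)%:E)%E by near: p; apply: ub; rewrite lte_fin; lra.
have fin : (L p `^ p^-1)%E \is a fin_num.
  by rewrite ge0_fin_numE ?poweR_ge0//; apply: le_lt_trans h2 (ltry _).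
move: h1 h2; rewrite /= -(fineK fin) !lee_fin fineK// => h1 h2.
by rewrite ler_norml; lra.
Unshelve. all: by end_near. Qed.

Lemma pack_ge0 k : (0 < k)%N -> [set: X] !=set0 -> (0 <= pack X k.+1)%E.
Proof.
move=> k0 [x _]; apply: (@pack_ge _ _ _ _ (fun=> x)) => i j _.
by rewrite mulr0 mdistxx.
Qed.

End eigenvalue_bounds.

Theorem theorem3p1 (R : realType) (d : measure_display)
    (X : borelMetricType R d) (m : probability X R)
    (compactX : compact [set: X]) (geodesicX : geodesic X)
    (supp_m : full_support m) (doubling_m : doubling m)
    (poincare_m : poincare m) (sobolev_lip_m : sobolev_to_lipschitz m)
    (k : nat) (k_gt0 : (0 < k)%N) :
  (lambda_max m k p `^ p^-1)%E @[p --> +oo%R] --> ((pack X k.+1)^-1)%E /\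
  (lambda_mean m k p `^ p^-1)%E @[p --> +oo%R] --> ((pack X k.+1)^-1)%E.
Proof.
have X0 : [set: X] !=set0.
  apply/set0P/eqP => X0; have := probability_setT m; rewrite X0 measure0 => /eqP.
  by rewrite eqe eq_sym oner_eq0.
have pack0 := pack_ge0 k_gt0 X0.
have l0 : (0 <= (pack X k.+1)^-1)%E by rewrite inve_ge0.
have low c : 0 < c -> (c%:E < (pack X k.+1)^-1)%E ->
    \forall p \near +oo, ((c `^ p)%:E <= lambda_max m k p)%E.
  move=> c0 cl; apply: lambda_max_ge_near => //.
  have : (pack X k.+1 < (c%:E)^-1)%E by rewrite inve_pgt ?inE ?lee_fin ?(ltW c0).
  by rewrite inver gt_eqF.
have up b : ((pack X k.+1)^-1 < b%:E)%E ->
    \forall p \near +oo, (lambda_max m k p <= (b `^ p)%:E)%E.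
  move=> lb; have b0 : 0 < b by rewrite -lte_fin; apply: le_lt_trans lb.
  have : ((b%:E)^-1 < pack X k.+1)%E by rewrite inve_plt ?inE ?lee_fin ?(ltW b0).
  rewrite inver gt_eqF// => bpack.
  have [r br rpack] : exists2 r, b^-1 < r & (r%:E < pack X k.+1)%E.
    case: (pack X k.+1) bpack => [r| |]//.
      by rewrite lte_fin => br; exists ((b^-1 + r) / 2); rewrite ?lte_fin; lra.
    by move=> _; exists (b^-1 + 1); rewrite ?ltry// ltrDl.
  have b'0 : 0 < b^-1 by rewrite invr_gt0.
  have r0 : 0 < r by apply: lt_trans br.
  have [x xr] := lt_pack rpack; apply: lambda_max_le_near xr => //.
  by rewrite -[b]invrK ltf_pV2 ?posrE.
split; first by apply: root_cvg => // p; exact: lambda_max_ge0.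
apply: root_cvg => //.
- move=> p; apply: le_trans (lambda_mean_ge m k p).
  by rewrite mule_ge0 ?lambda_max_ge0// lee_fin invr_ge0.
- move=> c c0 cl.
  have [c1 cc1 c1l] : exists2 c1, c < c1 & (c1%:E < (pack X k.+1)^-1)%E.
    case: ((pack X k.+1)^-1)%E cl => [r| |]//.
      by rewrite lte_fin => cr; exists ((c + r) / 2); rewrite ?lte_fin; lra.
    by move=> _; exists (c + 1); rewrite ?ltry// ltrDl.
  have c10 : 0 < c1 by apply: lt_trans cc1.
  have lowc1 := low _ c10 c1l.
  have q1 : 1 < c1 / c by rewrite ltr_pdivlMr// mul1r.
  have grow := powR_pinfty_ge k.+1%:R q1.
  near=> p; apply: le_trans (lambda_mean_ge m k p).
  rewrite lee_pdivlMl//.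
  apply: (@le_trans _ _ (c1 `^ p)%:E); last by near: p.
  rewrite -EFinM lee_fin -ler_pdivlMr ?powR_gt0//.
  rewrite -powRN -[X in _ * X](_ : c^-1 `^ p = _); last by rewrite powRN -powR_inv1 ?(ltW c0)// -powRrM mulN1r powRN.
  by rewrite -powRM ?invr_ge0 ?(ltW c10) ?(ltW c0)//; near: p.
- move=> b lb; have := up _ lb; apply: filterS => p; apply: le_trans.
  exact: lambda_mean_le.
Unshelve. all: by end_near. Qed.
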